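(* Consider the multi-environment structural causal model with interventions on $X$ described in the context, with acyclic graph $G$, intervention set $I\subseteq[d]$ and augmented model $\tilde M$. Let $$A(I)=\{j:\ j\in\mathtt{ch}(d+1),\ j\notin I,\ \mathtt{at}(j)\cap\mathtt{ch}(d+1)\cap I=\emptyset\},\qquad S_\star=\mathtt{pa}(d+1)\cup A(I)\cup\bigcup_{j\in A(I)}(\mathtt{pa}(j)\setminus\{d+1\}).$$ Let $t$ be a new environment generated by an SCM $M^{(t)}$ with the same parent sets and exogenous law $\nu$ and assignments $f_j^{(t)}$ satisfying $f_j^{(t)}\equiv f_j^{(0)}$ for all $j\in[d+1]\setminus I$ (only $X_I$ is intervened). Then $$\mathbb E[Y^{(t)}|X^{(t)}_{S_\star}]\equiv\mathbb E[Y^{(0)}|X^{(0)}_{S_\star}].$$ Suppose moreover that: (a) for every $S\subseteq[d]$ containing a descendant of $Y$ (i.e. $d+1\in\bigcup_{j\in S}\mathtt{at}(j)$), if $E$ and $Y$ are not conditionally independent given $X_S$ under $\tilde M$, then there exist $e,e'\in\mathcal E$ with $(\mu^{(e)}\wedge\mu^{(e')})(\{m^{(e,S)}\ne m^{(e',S)}\})>0$; (b) $\tilde M$ is faithful: for all disjoint $A,B,C\subseteq[d+2]$, if $Z_A,Z_B$ are conditionally independent given $Z_C$, then $A,B$ are d-separated by $C$ in $\tilde G$; (c) for the model $\bar M$ of the context: for every $S\subseteq[d]$ containing a descendant of $Y$, if $E$ and $Y$ are not conditionally independent given $X_S$ under $\bar M$, then $(\mu^{(0)}\wedge\mu^{(t)})(\{m^{(0,S)}\ne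 m^{(t,S)}\})>0$; and $\bar M$ is faithful (the property in (b) with $\tilde M,\tilde G$ replaced by $\bar M,\bar G$). Then $S_\star$ is the maximum set whose conditional expectation is transferable, in that for any $S\subseteq[d]$ such that $\mathbb E[Y^{(t)}|X^{(t)}_{S_\star\cup S}]\ne\mathbb E[Y^{(t)}|X^{(t)}_{S_\star}]$, one has $\mathbb E[Y^{(t)}|X_S^{(t)}]\ne\mathbb E[Y^{(0)}|X_S^{(0)}]$.
   Context: Multi-environment SCM. $\mathcal E=\{0,\dots,|\mathcal E|-1\}$. For each $e\in\mathcal E$, $Z^{(e)}=(Z^{(e)}_1,\dots,Z^{(e)}_{d+1})=(X_1^{(e)},\dots,X_d^{(e)},Y^{(e)})$ is generated by $$X_j^{(e)}\leftarrow f_j^{(e)}(Z^{(e)}_{\mathtt{pa}(j)},U_j),\ j=1,\dots,d,\qquad Y^{(e)}\leftarrow f_{d+1}(X^{(e)}_{\mathtt{pa}(d+1)},U_{d+1}).$$ The exogenous variables $U_1,\dots,U_{d+1}$ are independent with joint law $\nu$; $\nu$, the parent sets $\mathtt{pa}(j)\subseteq[d+1]$ and $f_{d+1}=f_{d+1}^{(0)}$ are the same for all $e$, while $f_j^{(e)}$, $j\le d$, may vary with $e$. The directed graph $G$ on $[d+1]$ with edges $i\to j$ iff $i\in\mathtt{pa}(j)$ is acyclic. $\mathbb E|Y^{(e)}|^2<\infty$ (also for $e=t$). $\mathtt{ch}(k)=\{j:k\in\mathtt{pa}(j)\}$; $\mathtt{at}(k)=\mathtt{pa}(k)\cup\bigcup_{j\in\mathtt{pa}(k)}\mathtt{at}(j)$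 (with respect to $G$). $I=\{j\in[d]:\exists e\in\mathcal E,\ f_j^{(e)}\ne f_j^{(0)}\}$. Augmented model $\tilde M$, on $Z=(Z_1,\dots,Z_{d+2})=(X_1,\dots,X_d,Y,E)$: $E\leftarrow U_{d+2}$ with $U_{d+2}\sim\mathrm{Uniform}(\mathcal E)$ independent of $(U_1,\dots,U_{d+1})\sim\nu$; $X_j\leftarrow f_j^{(0)}(Z_{\mathtt{pa}(j)},U_j)$ for $j\in[d]\setminus I$; $X_j\leftarrow f_j^{(E)}(Z_{\mathtt{pa}(j)},U_j)$ for $j\in I$; $Y\leftarrow f_{d+1}(X_{\mathtt{pa}(d+1)},U_{d+1})$. Its graph $\tilde G$ on $[d+2]$ is $G$ together with edges $d+2\to j$ for $j\in I$. Model $\bar M$: the same construction with $E\sim\mathrm{Uniform}(\{0,t\})$ in place of $\mathrm{Uniform}(\mathcal E)$, i.e. $X_j\leftarrow f_j^{(0)}(Z_{\mathtt{pa}(j)},U_j)$ for $j\in[d]\setminus I$, $X_j\leftarrow f_j^{(E)}(Z_{\mathtt{pa}(j)},U_j)$ for $j\in I$, $E\in\{0,t\}$, and $Y\leftarrow f_{d+1}(X_{\mathtt{pa}(d+1)},U_{d+1})$; its graph $\bar G$ is $G$ together with edges $d+2\to j$ for $j\in I$. Notation. $\mu^{(e)}$ is the law of $(X^{(e)},Y^{(e)})$ (also for $e=t$); $m^{(e,S)}(x)=\mathbb E[Y^{(e)}|X^{(e)}_S=x_S]$; $\mu\wedge\nu$ has density the pointwise minimum of the densities of $\mu,\nu$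 with respect to a common dominating measure. $\mathbb E[Y^{(t)}|X^{(t)}_{S}]\equiv\mathbb E[Y^{(0)}|X^{(0)}_{S}]$ means that the two regression functions are given by one common function of $x_S$. $\mathbb E[Y^{(t)}|X_S^{(t)}]\ne\mathbb E[Y^{(0)}|X_S^{(0)}]$ means $(\mu^{(0)}\wedge\mu^{(t)})(\{m^{(0,S)}\ne m^{(t,S)}\})>0$, and $\mathbb E[Y^{(t)}|X^{(t)}_{S_\star\cup S}]\ne\mathbb E[Y^{(t)}|X^{(t)}_{S_\star}]$ means inequality with positive probability. *)

(* Defs.v *)
From HB Require Import structures.
From mathcomp Require Import all_boot all_order all_algebra.
From mathcomp Require Import all_classical all_reals all_analysis.

Set Implicit Arguments.
Unset Strict Implicit.
Unset Printing Implicit Defensive.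

Import Order.TTheory GRing.Theory Num.Theory.

(* A directed graph on a finite type V is given by its parent sets:
   there is an edge i -> j iff i \in pa j. *)
Section Graphs.
Variables (V : finType) (pa : V -> {set V}).

Definition edge : rel V := fun i j => i \in pa j.

Definition ch (k : V) : {set V} := [set j | k \in pa j]%SET.

(* The nodes from which k can be reached by a directed path with at least one
   edge; atE is the recursive equation defining at(k) in an acyclic graph. *)
Definition at_ (k : V) : {set V} :=
  [set i | [exists j in pa k, connect edge i j]]%SET.

Lemma atE (k : V) :
  at_ k = (pa k :|: \bigcup_(j in pa k) at_ j)%SET.
Proof.
apply/setP => i; rewrite !inE; apply/exists_inP/orP => [[j jk]|].
  case/connectP => p; elim/last_ind: p j jk => [|p x _] j jk /=.
    by move=> _ ji; left; rewrite -ji.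
  rewrite rcons_path last_rcons => /andP[ip lx] jx; subst x.
  right; apply/bigcupP; exists j => //; rewrite inE.
  by apply/exists_inP; exists (last i p) => //; apply/connectP; exists p.
case=> [ik|/bigcupP[j jk]]; first by exists i => //; exact: connect0.
rewrite inE => /exists_inP[l lj il]; exists j => //.
exact: connect_trans il (connect1 _).
Qed.

Definition acyclic : Prop := forall k, k \notin at_ k.

Definition adjacent : rel V := fun i j => edge i j || edge j i.

(* v blocks the passage u, v, w: a collider v does so unless v or one of its
   descendants is in C, another node does so iff it is in C. *)
Definition blocked_at (C : {set V}) (u v w : V) : bool :=
  if edge u v && edge w v then
    (v \notin C) && ~~ [exists c in C, v \in at_ c]
  else v \in C.

Definition blocked (C : {set V}) (p : seq V) : bool :=
  [exists u, exists v, exists w, infix [:: u; v; w] p && blocked_at C u v w].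

Definition d_separated (A B C : {set V}) : Prop :=
  forall (a : V) (p : seq V), a \in A -> path adjacent a p -> uniq (a :: p) ->
    last a p \in B -> blocked C (a :: p).

End Graphs.

Section SelectedSet.
Variables (V : finType) (pa : V -> {set V}) (y : V) (I : {set V}).

Definition A_ : {set V} :=
  [set j in ch pa y | (j \notin I) && (at_ pa j :&: ch pa y :&: I == finset.set0)]%SET.

Definition S_star : {set V} :=
  (pa y :|: A_ :|: \bigcup_(j in A_) (pa j :\ y))%SET.

(* The graph with one further node None, the environment E, and edges E -> j
   for j \in I; the original nodes are the Some j. *)
Definition aug_pa (v : option V) : {set option V} :=
  if v is Some j then
    [set u | if u is Some i then i \in pa j else j \in I]%SET
  else finset.set0.

End SelectedSet.

Import numFieldNormedType.Exports.
Local Open Scope classical_set_scope.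
Local Open Scope ring_scope.

Section Probability.
Context (R : realType).

Definition is_cond_exp d (T : measurableType d) (P : probability T R)
    (G : set (set T)) (X W : T -> R) : Prop :=
  [/\ forall B, measurable B -> G (W @^-1` B),
      P.-integrable [set: T] (EFin \o W)
    & forall A, G A ->
        (\int[P]_(x in A) (W x)%:E = \int[P]_(x in A) (X x)%:E)%E].

(* One version of E[X | G]; 0 only if there is none. *)
Definition cond_exp d (T : measurableType d) (P : probability T R)
    (G : set (set T)) (X : T -> R) : T -> R :=
  xget (cst 0) [set W | is_cond_exp P G X W].

(* The sigma-algebra generated by the Z_i with i in A. *)
Definition sigma_of d (T : measurableType d) (V : finType)
    (Z : V -> T -> R) (A : {set V}) : set (set T) :=
  <<s \bigcup_(i in [set` A]) preimage_set_system [set: T] (Z i) measurable >>.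

Definition cond_indep d (T : measurableType d) (P : probability T R)
    (V : finType) (Z : V -> T -> R) (A B C : {set V}) : Prop :=
  forall F H, sigma_of Z A F -> sigma_of Z B H ->
    {ae P, forall x, cond_exp P (sigma_of Z C) (\1_(F `&` H)) x =
      cond_exp P (sigma_of Z C) (\1_F) x * cond_exp P (sigma_of Z C) (\1_H) x}.

Definition faithful d (T : measurableType d) (P : probability T R)
    (V : finType) (Z : V -> T -> R) (pa : V -> {set V}) : Prop :=
  forall A B C : {set V},
    [disjoint A & B]%B -> [disjoint A & C]%B -> [disjoint B & C]%B ->
    cond_indep P Z A B C -> d_separated pa A B C.

Definition mutually_independent d (T : measurableType d) (P : probability T R)
    n (dU : 'I_n -> measure_display) (TU : forall j, measurableType (dU j))
    (U : forall j, {mfun T >-> TU j}) : Prop :=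
  forall A : forall j, set (TU j), (forall j, measurable (A j)) ->
    fine (P [set w | forall j, A j (U j w)]) =
    \prod_(j < n) fine (P (U j @^-1` A j)).

(* The density of p /\ q is taken with respect to p + q, which dominates both
   p and q. *)
Section Minimum.
Local Open Scope charge_scope.
Context d (T : measurableType d) (p q : probability T R).

Let madd_fin : fin_num_fun (measure_add p q).
Proof.
by move=> A mA; rewrite measure_addE fin_numD !fin_num_measure.
Qed.

HB.instance Definition _ := Measure.on (measure_add p q).
HB.instance Definition _ :=
  Measure_isFinite.Build _ _ _ (measure_add p q) madd_fin.

Definition measure_min (A : set T) : \bar R :=
  (\int[measure_add p q]_(x in A)
     Order.min (('d (charge_of_finite_measure p) '/d (measure_add p q)) x)
               (('d (charge_of_finite_measure q) '/d (measure_add p q)) x))%E.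
End Minimum.

(* This is the uniform law on the labels of s when s has no repetitions. *)
Section Uniform.
Context (n : nat) (s : n.+1.-tuple nat).

Definition uniform_law : set nat -> \bar R :=
  msum (fun i => mscale (n.+1%:R^-1)%:nng (dirac (nth 0%N s i))) n.+1.

HB.instance Definition _ := Measure.on uniform_law.

Let uniform_law_setT : uniform_law [set: nat] = 1%E.
Proof.
rewrite /uniform_law /msum /mscale /= (eq_bigr (fun=> (n.+1%:R^-1)%:E)).
  by rewrite sumEFin sumr_const card_ord -(mulr_natl n.+1%:R^-1) mulfV ?pnatr_eq0.
by move=> i _; rewrite /mscale /= diracT mule1.
Qed.

HB.instance Definition _ :=
  Measure_isProbability.Build _ _ _ uniform_law uniform_law_setT.
End Uniform.

(* The joint law of the exogenous variables and of an independent label E that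
   is uniform on s. *)
Definition with_uniform d (T : measurableType d) (P : probability T R)
    n (s : n.+1.-tuple nat) : probability (T * nat)%type R :=
  (P \x uniform_law s)%E.

End Probability.

(* The nodes 1, ..., d+1 of the model are the elements of 'I_d.+1; the last one
   is Y, the others are X_1, ..., X_d. A subset S of [d] is thus a set of nodes
   with Ynode \notin S. *)
Notation Ynode := ord_max.

Section SCM.
Context (R : realType) (d : nat).
Context (dU : 'I_d.+1 -> measure_display)
        (TU : forall j, measurableType (dU j)).

(* The j-th assignment is a function of all of Z and of U_j; assignments_over
   says that it uses only the coordinates in pa j. *)
Definition assignments : Type := forall j : 'I_d.+1, d.+1.-tuple R * TU j -> R.

Definition assignments_over (pa : 'I_d.+1 -> {set 'I_d.+1}) (f : assignments) :
    Prop :=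
  forall j, measurable_fun setT (f j) /\
    forall (z z' : d.+1.-tuple R) (u : TU j),
      {in pa j, forall i, tnth z i = tnth z' i} -> f j (z, u) = f j (z', u).

(* The structural equations Z_j <- f_j^(E) (Z_pa(j), U_j), where the environment
   E is random in the augmented models and constant otherwise. *)
Definition generated (W : Type) (f : nat -> assignments) (E : W -> nat)
    (U : forall j, W -> TU j) (Z : W -> d.+1.-tuple R) : Prop :=
  forall w j, tnth (Z w) j = f (E w) j (Z w, U j w).

Definition interventions (f : nat -> assignments) (n : nat) : {set 'I_d.+1} :=
  [set j | (j != Ynode) && `[< exists2 e, (e < n)%N & f e j <> f 0%N j >]]%SET.

(* f_j^(e) for j \in I, and f_j^(0) for the other nodes, Y included. *)
Definition augmented (f : nat -> assignments) (I : {set 'I_d.+1}) :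
    nat -> assignments :=
  fun e j => if j \in I then f e j else f 0%N j.

Definition coordinate (j : 'I_d.+1) : d.+1.-tuple R -> R := fun z => tnth z j.

(* The augmented vector (X, Y, E) on the product of the space of the exogenous
   variables and of the space of the label E = U_{d+2}. *)
Definition with_env (W : Type) (Z : W * nat -> d.+1.-tuple R)
    (v : option 'I_d.+1) : W * nat -> R :=
  fun x => if v is Some j then tnth (Z x) j else x.2%:R.

Definition env_indep dW (W : measurableType dW) (P : probability (W * nat)%type R)
    (Z : W * nat -> d.+1.-tuple R) (S : {set 'I_d.+1}) : Prop :=
  cond_indep P (with_env Z) [set None]%SET [set Some Ynode]%SET
    [set Some j | j in S]%SET.

(* For mu the law of (X, Y): the functions x |-> E[Y | X_S = x_S], that is, the
   conditional expectations of the coordinate Y given the coordinates in S. *)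
Definition is_regression (mu : probability (d.+1.-tuple R) R)
    (S : {set 'I_d.+1}) (m : d.+1.-tuple R -> R) : Prop :=
  is_cond_exp mu (sigma_of coordinate S) (coordinate Ynode) m.

Definition regression (mu : probability (d.+1.-tuple R) R)
    (S : {set 'I_d.+1}) : d.+1.-tuple R -> R :=
  cond_exp mu (sigma_of coordinate S) (coordinate Ynode).

Definition regressions_agree (mu mu' : probability (d.+1.-tuple R) R)
    (S : {set 'I_d.+1}) : Prop :=
  exists m, is_regression mu S m /\ is_regression mu' S m.

Definition regressions_differ (mu mu' : probability (d.+1.-tuple R) R)
    (S : {set 'I_d.+1}) : Prop :=
  (0 < measure_min mu mu' [set x | regression mu S x <> regression mu' S x])%E.

End SCM.

(* Main.v *)
(* Let W be the set of the nodes that are neither an intervened child of Y nor a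
   descendant of one. In the mixture of the environments 0 and t, Y is
   independent of (X_{W \ Y}, E) given X_{S_star}. This is shown for growing
   ancestral sets, the nodes of W being added in a topological order. A node that
   is not a child of Y is a function of the known variables other than Y and of a
   fresh noise, so adding it keeps the conditional independence. A child of Y in
   W belongs to A(I): it is not intervened and its other parents are in S_star,
   so it is a function of Y, of the conditioning variables and of a fresh noise,
   and it can be adjoined to both the known and the conditioning variables.

   Hence a single function of X_{S_star} is a version of E[Y^(e) | X^(e)_S] for
   e = 0, t and all S with S_star <= S <= W \ Y, which gives the transferability
   of S_star. It also follows that E[Y^(t) | X_{S_star u S}] can differ from
   E[Y^(t) | X_{S_star}] only if S has a node outside W. Then the path
   E -> i <- Y through some intervened child i of Y is open given S, and
   faithfulness yields the dependence of E and Y given X_S. *)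
Require Import Defs.
From HB Require Import structures.
From mathcomp Require Import all_boot all_order all_algebra.
From mathcomp Require Import all_classical all_reals all_analysis.
From mathcomp Require Import measurable_realfun lra.

Set Implicit Arguments.
Unset Strict Implicit.
Unset Printing Implicit Defensive.

Import Order.TTheory GRing.Theory Num.Theory.
Import numFieldNormedType.Exports.
Local Open Scope classical_set_scope.
Local Open Scope ring_scope.

(** * Conditional means and conditional independence *)

Section Density.
Local Open Scope ereal_scope.
Context d (T : measurableType d) (R : realType) (P : probability T R).

(** The sign and integrability proofs are arguments so that the instances of measure and of finite
    measure can be attached to the set function itself. *)
Definition density (w : T -> \bar R) of (forall x, 0 <= w x)
  & P.-integrable setT w : set T -> \bar R := fun A => \int[P]_(x in A) w x.

Variables (w : T -> \bar R) (w0 : forall x, 0 <= w x)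
  (iw : P.-integrable setT w).
Local Notation nu := (density w0 iw).

Let nu0 : nu set0 = 0. Proof. exact: integral_set0. Qed.
Let nu_ge0 A : 0 <= nu A. Proof. exact: integral_ge0. Qed.
Let nu_sadd : semi_sigma_additive nu.
Proof. exact: (semi_sigma_additive_nng_induced (measurable_int _ iw)). Qed.

HB.instance Definition _ := isMeasure.Build _ _ _ nu nu0 nu_ge0 nu_sadd.

Let nu_fin : fin_num_fun nu.
Proof.
by move=> A mA; apply: integrable_fin_num => //; exact: integrableS iw.
Qed.

HB.instance Definition _ := Measure_isFinite.Build _ _ _ nu nu_fin.

(** [w] is a.e. the Radon-Nikodym derivative of [nu] with respect to [P], both having the same
    integral over every measurable set, so the change of variables for that derivative applies. *)
Lemma integral_density (h : T -> \bar R) : measurable_fun setT h ->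
  (forall x, 0 <= h x) -> \int[nu]_x h x = \int[P]_x (h x * w x).
Proof.
move=> mh h0.
have nuP : nu `<< P.
  apply/null_content_dominatesP => A mA PA0.
  by apply: null_set_integral => //; exact: measurable_int (integrableS _ _ _ iw).
rewrite -(Radon_Nikodym_SigmaFinite.change_of_variables nuP)//.
apply: ae_eq_integral => //.
- apply: emeasurable_funM => //.
  exact: measurable_int (Radon_Nikodym_SigmaFinite.f_integrable nuP).
- by apply: emeasurable_funM => //; exact: measurable_int iw.
- have : ae_eq P setT (Radon_Nikodym_SigmaFinite.f nu P) w.
    apply: integral_ae_eq => //.
    + exact: Radon_Nikodym_SigmaFinite.f_integrable.
    + exact: measurable_int iw.
    + by move=> E _ mE; rewrite -Radon_Nikodym_SigmaFinite.f_integral.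
  by apply: filterS => x /(_ Logic.I) E _; rewrite E.
Qed.

Context d' (T' : measurableType d') (m : {mfun T >-> T'}).

(** Integrals of functions of [m] against the weight [w] become integrals against one measure on
    [T'], so that identities between them follow from uniqueness of measures. *)
Definition weighted_law := pushforward nu m.

Local Notation law := weighted_law.

Let law0 : law set0 = 0. Proof. exact: measure0. Qed.
Let law_ge0 A : 0 <= law A. Proof. exact: integral_ge0. Qed.
Let law_sadd : semi_sigma_additive law.
Proof. exact: measure_semi_sigma_additive. Qed.

HB.instance Definition _ := isMeasure.Build _ _ _ law law0 law_ge0 law_sadd.

Let law_fin : fin_num_fun law.
Proof.
move=> A mA; apply: (fin_num_measure nu).
by rewrite -[X in measurable X]setTI; exact: measurable_funP.
Qed.

HB.instance Definition _ := Measure_isFinite.Build _ _ _ law law_fin.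

Lemma integral_weighted_law (h : T' -> \bar R) : measurable_fun setT h ->
  (forall x, 0 <= h x) -> \int[law]_x h x = \int[P]_x (h (m x) * w x).
Proof.
move=> mh h0; rewrite ge0_integral_pushforward// preimage_setT.
by rewrite integral_density// => [|x]; [|exact: h0]; exact: (measurableT_comp mh).
Qed.

End Density.

Section WeightedLaws.
Local Open Scope ereal_scope.
Context d (T : measurableType d) (R : realType) (P : probability T R).
Context d' (T' : measurableType d').

Lemma integral_preimageE (m : T -> T') A (w : T -> \bar R) :
  \int[P]_(x in m @^-1` A) w x = \int[P]_x ((\1_A (m x))%:E * w x).
Proof.
rewrite integral_mkcond epatch_indic; apply: eq_integral => x _ /=.
by rewrite muleC.
Qed.

(** The weighted laws of [m] for [w1] and [w2] are finite measures that agree on a generating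
    pi-system containing the whole space, hence they are equal. *)
Lemma eq_weighted (G : set (set T')) (m : T -> T') (w1 w2 : T -> \bar R) :
  measurable = <<s G >> -> setI_closed G -> G setT ->
  measurable_fun setT m ->
  (forall x, 0 <= w1 x) -> P.-integrable setT w1 ->
  (forall x, 0 <= w2 x) -> P.-integrable setT w2 ->
  (forall A, G A -> \int[P]_x ((\1_A (m x))%:E * w1 x) =
                    \int[P]_x ((\1_A (m x))%:E * w2 x)) ->
  forall h : T' -> \bar R, measurable_fun setT h -> (forall x, 0 <= h x) ->
  \int[P]_x (h (m x) * w1 x) = \int[P]_x (h (m x) * w2 x).
Proof.
move=> GE GI GT mm w10 iw1 w20 iw2 w12 h mh h0.
pose m' : {mfun T >-> T'} := HB.pack m (isMeasurableFun.Build _ _ _ _ _ mm).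
rewrite -(integral_weighted_law w10 iw1 m' mh h0).
rewrite -(integral_weighted_law w20 iw2 m' mh h0).
apply: eq_measure_integral => A mA _.
apply: (measure_unique G (fun=> setT)) => //.
- by rewrite bigcup_const//; exists 0%N.
- by move=> B /w12; rewrite -!integral_preimageE.
- by move=> _; rewrite ltey_eq; apply/orP; left; exact: fin_num_measure.
Qed.

End WeightedLaws.

Section ConditionalMeans.
Local Open Scope ereal_scope.
Context d (T : measurableType d) (R : realType) (P : probability T R).

(* g(c(k)) is a version of the conditional mean of w given k. *)
Definition cond_mean dK (K : measurableType dK) dC (C : measurableType dC)
    (w : T -> \bar R) (k : T -> K) (c : K -> C) (g : C -> \bar R) : Prop :=
  [/\ measurable_fun setT g, forall x, 0 <= g x &
      forall A, measurable A -> \int[P]_x ((\1_A (k x))%:E * w x) =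
        \int[P]_x ((\1_A (k x))%:E * g (c (k x)))].

Section Existence.
Context dC (C : measurableType dC) (c : T -> C).
Hypothesis mc : measurable_fun setT c.

(** The law of [c] weighted by [w] is absolutely continuous with respect to the law of [c]; its
    Radon-Nikodym derivative is the conditional mean. *)
Lemma cond_mean_exists (w : T -> \bar R) : (forall x, 0 <= w x) ->
  P.-integrable setT w -> exists g, cond_mean w c id g.
Proof.
move=> w0 iw.
pose c' : {mfun T >-> C} := HB.pack c (isMeasurableFun.Build _ _ _ _ _ mc).
pose nu : {finite_measure set C -> \bar R} := weighted_law w0 iw c'.
have numu : nu `<< distribution P c'.
  apply/null_content_dominatesP => A mA PA0.
  apply: null_set_integral => //.
  - by rewrite -[X in measurable X]setTI; exact: mc.
  - by apply: measurable_funTS; exact: measurable_int iw.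
have [g [g0 ig nug]] := radon_nikodym_finite numu.
exists g; split => //; first exact: measurable_int ig.
move=> A mA; rewrite -!integral_preimageE.
rewrite -[RHS](ge0_integral_pushforward mc P)//; last first.
  by apply: measurable_funTS; exact: measurable_int ig.
exact: nug.
Qed.
End Existence.

End ConditionalMeans.

Section CondMeanTheory.
Local Open Scope ereal_scope.
Context d (T : measurableType d) (R : realType) (P : probability T R).

Lemma ge0_integrable (w : T -> \bar R) : measurable_fun setT w ->
  (forall x, 0 <= w x) -> \int[P]_x w x < +oo -> P.-integrable setT w.
Proof.
move=> mw w0 woo; apply/integrableP; split=> //.
by under eq_integral do rewrite gee0_abs//.
Qed.

Lemma ge0_integrable_lty (w : T -> \bar R) : (forall x, 0 <= w x) ->
  P.-integrable setT w -> \int[P]_x w x < +oo.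
Proof.
move=> w0 /integrableP[_].
by under eq_integral do rewrite gee0_abs//.
Qed.

Lemma eindic_ge0 K (A : set K) z : 0 <= (\1_A z)%:E :> \bar R.
Proof. by rewrite lee_fin indicE. Qed.

Lemma measurable_eindic dK (K : measurableType dK) (A : set K) : measurable A ->
  measurable_fun setT (fun z => (\1_A z)%:E : \bar R).
Proof. by move=> mA; apply/measurable_EFinP; exact: measurable_indic. Qed.

Lemma eindicX K L (A : set K) (B : set L) a b :
  (\1_(A `*` B) (a, b))%:E = (\1_A a)%:E * (\1_B b)%:E :> \bar R.
Proof. by rewrite !indicE classical_sets.in_setX -EFinM -natrM mulnb. Qed.

Section Indicator.
Context dK (K : measurableType dK) (k : T -> K) (A : set K).
Hypotheses (mk : measurable_fun setT k) (mA : measurable A).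

Definition ind (x : T) : \bar R := (\1_A (k x))%:E.

Lemma ind_ge0 x : 0 <= ind x.
Proof. by rewrite lee_fin indicE. Qed.

Lemma ind_integrable : P.-integrable setT ind.
Proof.
have mkA : measurable (k @^-1` A) by rewrite -[X in measurable X]setTI; exact: mk.
apply: ge0_integrable; last 1 first.
- rewrite [X in X < _](_ : _ = P (k @^-1` A)).
    by rewrite ltey_eq fin_num_measure.
  by rewrite -[in RHS](setIT (k @^-1` A)) -integral_indic.
- apply/measurable_EFinP; apply: (measurableT_comp _ mk).
  exact: measurable_indic.
- exact: ind_ge0.
Qed.

End Indicator.

Lemma cond_mean_integrable dK (K : measurableType dK) dC (C : measurableType dC)
    (w : T -> \bar R) (k : T -> K) (c : K -> C) g :
  measurable_fun setT k -> measurable_fun setT c ->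
  (forall x, 0 <= w x) -> P.-integrable setT w -> cond_mean P w k c g ->
  P.-integrable setT (fun x => g (c (k x))).
Proof.
move=> mk mc w0 iw [mg g0 wg]; apply: ge0_integrable => //.
  by apply: (measurableT_comp mg); exact: measurableT_comp.
have := wg _ measurableT; under eq_integral do rewrite indicT mul1e.
under [in RHS]eq_integral do rewrite indicT mul1e.
by move=> <-; exact: ge0_integrable_lty iw.
Qed.

(** The defining identity compares two weighted laws of [k] on all measurable sets, so it extends
    from indicators to nonnegative functions. *)
Lemma integral_cond_mean dK (K : measurableType dK) dC (C : measurableType dC)
    (w : T -> \bar R) (k : T -> K) (c : K -> C) g :
  measurable_fun setT k -> measurable_fun setT c ->
  (forall x, 0 <= w x) -> P.-integrable setT w -> cond_mean P w k c g ->
  forall h : K -> \bar R, measurable_fun setT h -> (forall x, 0 <= h x) ->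
  \int[P]_x (h (k x) * w x) = \int[P]_x (h (k x) * g (c (k x))).
Proof.
move=> mk mc w0 iw wg; have ig := cond_mean_integrable mk mc w0 iw wg.
case: wg => mg g0 wg.
apply: (eq_weighted (G := measurable)) => //.
- by apply/esym; apply: sigma_algebra_id; exact: sigma_algebra_measurable.
- exact: measurableI.
Qed.

Section CondIndep.
Context dY (Y : measurableType dY) dK (K : measurableType dK)
  dC (C : measurableType dC).

(* As c(k) is a function of k, conditional independence given c(k) means that
   the conditional means of the indicators of y given k factor through c. *)
Definition independent_given (y : T -> Y) (k : T -> K) (c : K -> C) : Prop :=
  forall B, measurable B -> exists g, cond_mean P (ind y B) k c g.

Context (y : T -> Y) (k : T -> K) (c : K -> C).
Hypotheses (my : measurable_fun setT y) (mk : measurable_fun setT k)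
  (mc : measurable_fun setT c) (ykc : independent_given y k c).

Let mck : measurable_fun setT (fun x => c (k x)).
Proof. exact: measurableT_comp. Qed.

(* By symmetry of conditional independence: the conditional mean of the
   indicator of A given c(k) is one given (y, c(k)) as well. *)
Lemma independent_given_mean (h : Y * C -> \bar R) :
  measurable_fun setT h -> (forall x, 0 <= h x) ->
  P.-integrable setT (fun x => h (y x, c (k x))) ->
  exists g, cond_mean P (fun x => h (y x, c (k x))) k c g.
Proof.
move=> mh h0 ih; set w := fun x => h (y x, c (k x)).
have w0 x : 0 <= w x by exact: h0.
have [p wp] := cond_mean_exists mck w0 ih.
have [mp p0 _] := wp.
exists p; split=> // A mA.
have mA1 := measurable_eindic mA; have A10 := @eindic_ge0 _ A.
have iA := ind_integrable mk mA; have A0 := ind_ge0 k A.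
have [q Aq] := cond_mean_exists mck A0 iA.
have [mq q0 _] := Aq.
have id_m : measurable_fun setT (@id C) by exact: measurable_id.
have intA := integral_cond_mean mck id_m A0 iA Aq.
have intw := integral_cond_mean mck id_m w0 ih wp.
have iq := cond_mean_integrable mck id_m A0 iA Aq.
have mm : measurable_fun setT (fun x => (y x, c (k x))).
  exact: measurable_fun_pair.
(* On a rectangle [B] times [D], the indicator of [B] is replaced by [g], then that of [A] by [q],
   then [g] is turned back into the indicator of [B]. Each time the remaining factor is a function
   of [k], or of [c(k)], as the conditional mean requires. *)
have eqm : \int[P]_x (h (y x, c (k x)) * ind k A x) =
           \int[P]_x (h (y x, c (k x)) * q (c (k x))).
  apply: (eq_weighted (measurable_prod_measurableType _ _) _ _ mm) => //.
  - move=> _ _ [B1 mB1 [D1 mD1 <-]] [B2 mB2 [D2 mD2 <-]].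
    exists (B1 `&` B2); first exact: measurableI.
    exists (D1 `&` D2); first exact: measurableI.
    by rewrite setXI.
  - by exists setT => //; exists setT => //; rewrite setXTT.
  - move=> _ [B mB [D mD <-]].
    have [g Bg] := ykc mB; have [mg g0 _] := Bg.
    have iB := ind_integrable my mB; have B0 := ind_ge0 y B.
    have intB := integral_cond_mean mk mc B0 iB Bg.
    have mD1 := measurable_eindic mD; have D10 := @eindic_ge0 _ D.
    transitivity (\int[P]_x (((\1_D (c (k x)))%:E * (\1_A (k x))%:E) * ind y B x)).
      by apply: eq_integral => x _; rewrite eindicX (muleC (\1_B _)%:E) muleAC.
    rewrite (intB (fun z => (\1_D (c z))%:E * (\1_A z)%:E)); first last.
    - by move=> z; rewrite mule_ge0.
    - by apply: emeasurable_funM => //; exact: (measurableT_comp mD1).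
    transitivity (\int[P]_x (((\1_D (c (k x)))%:E * g (c (k x))) * ind k A x)).
      by apply: eq_integral => x _; rewrite muleAC.
    rewrite (intA (fun z => (\1_D z)%:E * g z)); first last.
    - by move=> z; rewrite mule_ge0.
    - exact: emeasurable_funM.
    transitivity (\int[P]_x (((\1_D (c (k x)))%:E * q (c (k x))) * g (c (k x)))).
      by apply: eq_integral => x _; rewrite muleAC.
    rewrite -(intB (fun z => (\1_D (c z))%:E * q (c z))); first last.
    - by move=> z; rewrite mule_ge0.
    - apply: emeasurable_funM; first exact: (measurableT_comp mD1).
      exact: (measurableT_comp mq).
    by apply: eq_integral => x _; rewrite eindicX (muleC (\1_B _)%:E) muleAC.
transitivity (\int[P]_x (h (y x, c (k x)) * ind k A x)).
  by apply: eq_integral => x _; rewrite muleC.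
(* Against [q(c(k))] the weight [w] averages to [p(c(k))], and against [p(c(k))] the factor
   [q(c(k))] goes back to the indicator of [A]. *)
rewrite eqm.
transitivity (\int[P]_x (q (c (k x)) * w x)).
  by apply: eq_integral => x _; rewrite muleC.
rewrite (intw q)//.
transitivity (\int[P]_x (p (c (k x)) * q (c (k x)))).
  by apply: eq_integral => x _; rewrite muleC.
by rewrite -(intA p)//; apply: eq_integral => x _; rewrite muleC.
Qed.

End CondIndep.
End CondMeanTheory.

(** * Adding a variable driven by a fresh noise *)

Section Independence.
Local Open Scope ereal_scope.
Context d (T : measurableType d) (R : realType) (P : probability T R).
Context dV (V : measurableType dV) (U : {mfun T >-> V}).

Definition independent_of dK (K : measurableType dK) (k : T -> K) : Prop :=
  forall A B, measurable A -> measurable B ->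
    P (k @^-1` A `&` U @^-1` B) = P (k @^-1` A) * P (U @^-1` B).

Section Freezing.
Context dK (K : measurableType dK) (k : T -> K).
Hypotheses (mk : measurable_fun setT k) (kU : independent_of k).

Lemma measurable_frozen (h : K * V -> \bar R) : measurable_fun setT h ->
  (forall x, 0 <= h x) ->
  measurable_fun setT (fun a => \int[distribution P U]_u h (a, u)).
Proof. by move=> mh h0; exact: measurable_fun_fubini_tonelli_F. Qed.

Lemma frozen_ge0 (h : K * V -> \bar R) a : (forall x, 0 <= h x) ->
  0 <= \int[distribution P U]_u h (a, u).
Proof. by move=> h0; exact: integral_ge0. Qed.

(** By independence the law of [(k, U)] is a product, and Tonelli integrates the noise out with the
    value of [k] held fixed. *)
Lemma integral_frozen (p : K -> \bar R) (h : K * V -> \bar R) :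
  measurable_fun setT p -> (forall a, 0 <= p a) ->
  measurable_fun setT h -> (forall x, 0 <= h x) ->
  \int[P]_x (p (k x) * h (k x, U x)) =
  \int[P]_x (p (k x) * \int[distribution P U]_u h (k x, u)).
Proof.
move=> mp p0 mh h0.
pose k' : {mfun T >-> K} := HB.pack k (isMeasurableFun.Build _ _ _ _ _ mk).
have mkU : measurable_fun setT (fun x => (k x, U x)).
  by apply: measurable_fun_pair => //; exact: measurable_funP.
pose kU' : {mfun T >-> (K * V)%type} :=
  HB.pack (fun x => (k x, U x)) (isMeasurableFun.Build _ _ _ _ _ mkU).
have lawE X : measurable X ->
    (distribution P k' \x distribution P U) X = distribution P kU' X.
  by apply: product_measure_unique => A B mA mB; exact: kU.
pose ph (z : K * V) := p z.1 * h z.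
have mph : measurable_fun setT ph.
  by apply: emeasurable_funM => //; exact: (measurableT_comp mp).
have ph0 z : 0 <= ph z by rewrite mule_ge0.
rewrite -[LHS](ge0_integral_distribution kU' mph ph0).
transitivity (\int[distribution P k' \x distribution P U]_b ph b).
  by apply: eq_measure_integral => A mA _; exact/esym/lawE.
rewrite fubini_tonelli1//.
rewrite (ge0_integral_distribution k'); first last.
- by move=> a; exact: integral_ge0.
- exact: measurable_fun_fubini_tonelli_F.
apply: eq_integral => x _ /=; rewrite /fubini_F /ph/= ge0_integralZl//.
exact: (measurableT_comp mh).
Qed.

End Freezing.
End Independence.

Section AddVariable.
Local Open Scope ereal_scope.
Context d (T : measurableType d) (R : realType) (P : probability T R).
Context dV (V : measurableType dV) (U : {mfun T >-> V}).
Context dY (Y : measurableType dY) dK (K : measurableType dK)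
  dC (C : measurableType dC) dZ (Z : measurableType dZ).
Context (y : T -> Y) (k : T -> K) (c : K -> C) (z : T -> Z).
Hypotheses (my : measurable_fun setT y) (mk : measurable_fun setT k)
  (mc : measurable_fun setT c) (mz : measurable_fun setT z).

(** Freezing [k] leaves the probability that [f(a, U)] lies in [B], evaluated at [a = c(k)]. *)
Lemma independent_given_noise (f : C * V -> Y) : measurable_fun setT f ->
  (forall x, y x = f (c (k x), U x)) -> independent_of P U k ->
  independent_given P y k c.
Proof.
move=> mf yE kU B mB.
pose h (b : C * V) : \bar R := (\1_B (f b))%:E.
have mh : measurable_fun setT h.
  exact: (measurableT_comp (measurable_eindic mB) mf).
have h0 b : 0 <= h b by exact: eindic_ge0.
exists (fun a => \int[distribution P U]_u h (a, u)).
split; [exact: measurable_frozen | by move=> a; exact: frozen_ge0|].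
move=> A mA.
pose h' (b : K * V) := h (c b.1, b.2).
have mh' : measurable_fun setT h'.
  apply: (measurableT_comp mh); apply: measurable_fun_pair => //.
  exact: (measurableT_comp mc).
have h'0 b : 0 <= h' b by exact: h0.
rewrite -(integral_frozen mk kU (measurable_eindic mA) (@eindic_ge0 _ _ A) mh')//.
by apply: eq_integral => x _; rewrite /ind yE.
Qed.

(** The same [g] serves for [(k, z)] as for [k]: the new noise is independent of [(k, y)], so [z]
    can be integrated out before [y] is averaged, and restored afterwards. *)
Lemma independent_given_nonchild (f : K * V -> Z) : measurable_fun setT f ->
  (forall x, z x = f (k x, U x)) ->
  independent_of P U (fun x => (k x, y x)) ->
  independent_given P y k c ->
  independent_given P y (fun x => (k x, z x)) (c \o fst).
Proof.
move=> mf zE kyU ykc B mB.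
have [g Bg] := ykc _ mB; have [mg g0 _] := Bg.
exists g; split=> // A mA.
pose h (b : (K * Y) * V) : \bar R := (\1_A (b.1.1, f (b.1.1, b.2)))%:E.
have mh : measurable_fun setT h.
  apply: (measurableT_comp (measurable_eindic mA)).
  apply: measurable_fun_pair; first exact: (measurableT_comp measurable_fst).
  apply: (measurableT_comp mf); apply: measurable_fun_pair => //.
  exact: (measurableT_comp measurable_fst).
have h0 b : 0 <= h b by exact: eindic_ge0.
have mky : measurable_fun setT (fun x => (k x, y x)) by exact: measurable_fun_pair.
(* [th a] is the probability that [(k, z)] lies in [A] given [k = a]; further conditioning on [y]
   does not change it. *)
pose th a := \int[distribution P U]_u (\1_A (a, f (a, u)))%:E : \bar R.
have mth : measurable_fun setT th.
  apply: (@measurable_frozen _ _ _ _ _ _ _ _ _ (fun b => (\1_A (b.1, f b))%:E)).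
  - apply: (measurableT_comp (measurable_eindic mA)).
    exact: measurable_fun_pair.
  - by move=> b; exact: eindic_ge0.
have th0 a : 0 <= th a by apply: integral_ge0 => u _; exact: eindic_ge0.
transitivity (\int[P]_x ((\1_B (y x))%:E * h ((k x, y x), U x))).
  by apply: eq_integral => x _; rewrite /ind zE muleC.
have mB2 : measurable_fun setT (fun b : K * Y => (\1_B b.2)%:E : \bar R).
  exact: (measurableT_comp (measurable_eindic mB) measurable_snd).
rewrite (integral_frozen mky kyU mB2 (fun b => @eindic_ge0 _ _ B b.2) mh h0).
transitivity (\int[P]_x (th (k x) * ind R y B x)).
  by apply: eq_integral => x _; rewrite muleC.
rewrite (integral_cond_mean mk mc (@ind_ge0 _ _ _ _ _ _ _)
  (ind_integrable _ my mB) Bg)//.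
transitivity (\int[P]_x (g (c (k x)) * h ((k x, y x), U x))).
  have mgc : measurable_fun setT (fun b : K * Y => g (c b.1)).
    by apply: (measurableT_comp mg); exact: (measurableT_comp mc).
  rewrite (integral_frozen mky kyU mgc (fun b => g0 _) mh h0).
  by apply: eq_integral => x _; rewrite muleC.
by apply: eq_integral => x _; rewrite muleC zE.
Qed.

(** Let [q(c(k))] be the conditional mean of the indicator of [A]. A weight whose mean given [k]
    factors through [c] has the same integral against that indicator as against [q(c(k))], which
    only involves events of [c(k)]. *)
Lemma eq_integral_cond_mean (w1 w2 : T -> \bar R) p1 p2 :
  (forall x, 0 <= w1 x) -> P.-integrable setT w1 ->
  (forall x, 0 <= w2 x) -> P.-integrable setT w2 ->
  cond_mean P w1 k c p1 -> cond_mean P w2 k c p2 ->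
  (forall D, measurable D -> \int[P]_x ((\1_D (c (k x)))%:E * w1 x) =
                             \int[P]_x ((\1_D (c (k x)))%:E * w2 x)) ->
  forall A, measurable A -> \int[P]_x ((\1_A (k x))%:E * w1 x) =
                            \int[P]_x ((\1_A (k x))%:E * w2 x).
Proof.
move=> w10 iw1 w20 iw2 wp1 wp2 w12 A mA.
have mck : measurable_fun setT (fun x => c (k x)) by exact: (measurableT_comp mc).
have iA := ind_integrable P mk mA; have A0 x : 0 <= ind R k A x by exact: ind_ge0.
have [q Aq] := cond_mean_exists mck A0 iA; have [mq q0 _] := Aq.
have id_m : measurable_fun setT (@id C) by exact: measurable_id.
suff mean w p : (forall x, 0 <= w x) -> P.-integrable setT w ->
    cond_mean P w k c p ->
    \int[P]_x ((\1_A (k x))%:E * w x) = \int[P]_x (q (c (k x)) * w x).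
  rewrite (mean _ _ w10 iw1 wp1) (mean _ _ w20 iw2 wp2).
  apply: (eq_weighted (G := measurable)) => //; last exact: measurableI.
  by apply/esym; apply: sigma_algebra_id; exact: sigma_algebra_measurable.
move=> w0 iw wp; have [mp p0 ->//] := wp.
rewrite (integral_cond_mean (h := fun a => q (c a)) mk mc w0 iw wp)//; last first.
  exact: (measurableT_comp mq).
transitivity (\int[P]_x (p (c (k x)) * ind R k A x)).
  by apply: eq_integral => x _; rewrite muleC.
rewrite (integral_cond_mean mck id_m A0 iA Aq mp p0).
by apply: eq_integral => x _; rewrite muleC.
Qed.

(** Integrating out the noise turns the weight into a function [H] of [(y, c(k))], to which
    [independent_given_mean] applies. *)
Lemma independent_given_child_mean (f : C * Y * V -> Z)
    (h : C * Y * Z -> \bar R) :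
  measurable_fun setT f -> (forall x, z x = f (c (k x), y x, U x)) ->
  independent_of P U (fun x => (k x, y x)) -> independent_given P y k c ->
  measurable_fun setT h -> (forall b, 0 <= h b) ->
  P.-integrable setT (fun x => h (c (k x), y x, z x)) ->
  exists p, cond_mean P (fun x => h (c (k x), y x, z x)) k c p.
Proof.
move=> mf zE kyU ykc mh h0 ih.
pose h1 (b : (K * Y) * V) := h (c b.1.1, b.1.2, f (c b.1.1, b.1.2, b.2)).
have mcK : measurable_fun setT (fun b : (K * Y) * V => (c b.1.1, b.1.2)).
  apply: measurable_fun_pair; last exact: (measurableT_comp measurable_snd).
  by apply: (measurableT_comp mc); exact: (measurableT_comp measurable_fst).
have mh1 : measurable_fun setT h1.
  apply: (measurableT_comp mh); apply: measurable_fun_pair => //.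
  by apply: (measurableT_comp mf); exact: measurable_fun_pair.
have h10 b : 0 <= h1 b by exact: h0.
pose H (b : Y * C) := \int[distribution P U]_u h (b.2, b.1, f (b.2, b.1, u)).
have mH : measurable_fun setT H.
  pose h2 (b : (Y * C) * V) := h (b.1.2, b.1.1, f (b.1.2, b.1.1, b.2)).
  have msw : measurable_fun setT (fun b : (Y * C) * V => (b.1.2, b.1.1)).
    apply: measurable_fun_pair; first exact: (measurableT_comp measurable_snd).
    exact: (measurableT_comp measurable_fst).
  apply: (@measurable_frozen _ _ _ P _ _ U _ _ h2).
    apply: (measurableT_comp mh); apply: measurable_fun_pair => //.
    by apply: (measurableT_comp mf); exact: measurable_fun_pair.
  by move=> b; exact: h0.
have H0 b : 0 <= H b by apply: integral_ge0.
have mky : measurable_fun setT (fun x => (k x, y x)) by exact: measurable_fun_pair.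
have hH A : measurable A -> \int[P]_x ((\1_A (k x))%:E * h (c (k x), y x, z x)) =
    \int[P]_x ((\1_A (k x))%:E * H (y x, c (k x))).
  move=> mA.
  have mA1 : measurable_fun setT (fun b : K * Y => (\1_A b.1)%:E : \bar R).
    exact: (measurableT_comp (measurable_eindic mA) measurable_fst).
  rewrite -(integral_frozen mky kyU mA1 (fun b => @eindic_ge0 _ _ A b.1) mh1 h10).
  by apply: eq_integral => x _; rewrite zE.
have mHx : measurable_fun setT (fun x => H (y x, c (k x))).
  apply: (measurableT_comp mH); apply: measurable_fun_pair => //.
  exact: (measurableT_comp mc).
have iH : P.-integrable setT (fun x => H (y x, c (k x))).
  apply: ge0_integrable => //.
  have := hH _ measurableT.
  under eq_integral do rewrite indicT mul1e.
  under [in RHS]eq_integral do rewrite indicT mul1e.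
  by move=> <-; exact: ge0_integrable_lty ih.
have [p Hp] := independent_given_mean my mk mc ykc mH H0 iH.
by exists p; case: Hp => mp p0 Hp; split=> // A mA; rewrite hH// Hp.
Qed.

(* With g(c(k), z) the conditional mean of the indicator of B given (c(k), z), the
   weights 1_D(z) 1_B(y) and 1_D(z) g(c(k), z) both have a conditional mean given k
   that is a function of c(k), so it is enough to compare them on the events of
   c(k), where they agree by the choice of g. *)
Lemma independent_given_child (f : C * Y * V -> Z) : measurable_fun setT f ->
  (forall x, z x = f (c (k x), y x, U x)) ->
  independent_of P U (fun x => (k x, y x)) -> independent_given P y k c ->
  independent_given P y (fun x => (k x, z x)) (fun b => (c b.1, b.2)).
Proof.
move=> mf zE kyU ykc B mB.
have iB := ind_integrable P my mB; have B0 x : 0 <= ind R y B x by exact: ind_ge0.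
have mkz : measurable_fun setT (fun x => (k x, z x)) by exact: measurable_fun_pair.
have mcz : measurable_fun setT (fun b : K * Z => (c b.1, b.2)).
  by apply: measurable_fun_pair => //; exact: (measurableT_comp mc).
have mckz : measurable_fun setT (fun x => (c (k x), z x)).
  by apply: measurable_fun_pair => //; exact: (measurableT_comp mc).
have [g Bg] := cond_mean_exists mckz B0 iB; have [mg g0 Bg'] := Bg.
have ig := cond_mean_integrable mckz (@measurable_id _ _ _) B0 iB Bg.
exists g; split=> // A mA.
apply: (eq_weighted (measurable_prod_measurableType _ _) _ _ mkz B0 iB _ ig _
  (measurable_eindic mA)) => //.
- move=> _ _ [A1 mA1 [D1 mD1 <-]] [A2 mA2 [D2 mD2 <-]].
  exists (A1 `&` A2); first exact: measurableI.
  exists (D1 `&` D2); first exact: measurableI.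
  by rewrite setXI.
- by exists setT => //; exists setT => //; rewrite setXTT.
- move=> _ [A1 mA1 [D mD <-]].
  pose h1 (b : C * Y * Z) : \bar R := (\1_D b.2)%:E * (\1_B b.1.2)%:E.
  pose h2 (b : C * Y * Z) : \bar R := (\1_D b.2)%:E * g (b.1.1, b.2).
  have mD' : measurable_fun setT (fun b : C * Y * Z => (\1_D b.2)%:E : \bar R).
    exact: (measurableT_comp (measurable_eindic mD)).
  have mh1 : measurable_fun setT h1.
    apply: emeasurable_funM => //; apply: (measurableT_comp (measurable_eindic mB)).
    exact: (measurableT_comp measurable_snd).
  have mh2 : measurable_fun setT h2.
    apply: emeasurable_funM => //; apply: (measurableT_comp mg).
    by apply: measurable_fun_pair => //; exact: (measurableT_comp measurable_fst).
  have h10 b : 0 <= h1 b by rewrite mule_ge0// eindic_ge0.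
  have h20 b : 0 <= h2 b by rewrite mule_ge0// eindic_ge0.
  have mckyz : measurable_fun setT (fun x => (c (k x), y x, z x)).
    do 2 apply: measurable_fun_pair => //; exact: (measurableT_comp mc).
  have iind (w : T -> \bar R) : (forall x, 0 <= w x) -> P.-integrable setT w ->
      P.-integrable setT (fun x => (\1_D (z x))%:E * w x).
    move=> w0 iw; have mw := measurable_int _ iw.
    apply: le_integrable iw => //.
      apply: emeasurable_funM => //.
      exact: (measurableT_comp (measurable_eindic mD)).
    move=> x _; rewrite !gee0_abs ?mule_ge0 ?eindic_ge0//.
    by rewrite indicE; case: (_ \in _); rewrite ?mul1e ?mul0e.
  have i1 : P.-integrable setT (fun x => h1 (c (k x), y x, z x)) by exact: iind.
  have i2 : P.-integrable setT (fun x => h2 (c (k x), y x, z x)) by exact: iind.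
  have [p1 wp1] := independent_given_child_mean mf zE kyU ykc mh1 h10 i1.
  have [p2 wp2] := independent_given_child_mean mf zE kyU ykc mh2 h20 i2.
  transitivity (\int[P]_x ((\1_A1 (k x))%:E * h1 (c (k x), y x, z x))).
    by apply: eq_integral => x _; rewrite eindicX muleA.
  rewrite (eq_integral_cond_mean _ i1 _ i2 wp1 wp2)//.
    by apply: eq_integral => x _; rewrite eindicX muleA.
  (* On an event [E] of [c(k)] the claim is the defining identity of [g] on the rectangle [E] times
     [D]. *)
  move=> E mE; have mED : measurable (E `*` D) by exact: measurableX.
  have := Bg' _ mED; under eq_integral do rewrite eindicX -muleA.
  by under [in RHS]eq_integral do rewrite eindicX -muleA.
Qed.

End AddVariable.

(** * Ancestral sets and the set S_star *)

Section Ancestors.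
Variables (V : finType) (pa : V -> {set V}).
Local Open Scope set_scope.

Lemma pa_at i j : i \in pa j -> i \in at_ pa j.
Proof. by move=> ij; rewrite atE inE ij. Qed.

Lemma at_trans i j k : i \in at_ pa j -> j \in at_ pa k -> i \in at_ pa k.
Proof.
rewrite !inE => /exists_inP[j' j'j ij'] /exists_inP[k' k'k jk'].
apply/exists_inP; exists k' => //; apply: connect_trans ij' _.
exact: connect_trans (connect1 _) jk'.
Qed.

Definition ancestral (T : {set V}) : bool := [forall j in T, pa j \subset T].

Lemma ancestralP (T : {set V}) :
  reflect (forall i j, j \in T -> i \in pa j -> i \in T) (ancestral T).
Proof.
apply: (iffP forall_inP) => [TP i j jT|TP j jT]; first exact/fintype.subsetP/TP.
by apply/fintype.subsetP => i; exact: TP jT.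
Qed.

Lemma ancestral_at (T : {set V}) i j :
  ancestral T -> j \in T -> i \in at_ pa j -> i \in T.
Proof.
move=> /ancestralP TP jT; rewrite inE => /exists_inP[j' j'j].
have {j jT j'j} : j' \in T by exact: TP jT j'j.
move=> + /connectP[p].
elim/last_ind: p j' => [|p x IHp] j' j'T /=; first by move=> _ <-.
rewrite rcons_path last_rcons => /andP[ip px] j'x; subst x.
exact: IHp (TP _ _ j'T px) ip _.
Qed.

Lemma ancestral_at_set j : ancestral (at_ pa j).
Proof. by apply/ancestralP => i k kj /pa_at ik; exact: at_trans ik kj. Qed.

Lemma ancestralU1 (T : {set V}) j :
  ancestral T -> pa j \subset T -> ancestral (j |: T).
Proof.
move=> /ancestralP TP /fintype.subsetP jT; apply/ancestralP => i k /setU1P[->|kT] ik.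
  by rewrite inE jT ?orbT.
by rewrite inE (TP _ _ kT ik) orbT.
Qed.

Hypothesis acyc : acyclic pa.

(** Ancestors of [i] are ancestors of [j], and by acyclicity [i] is an ancestor of [j] but not of
    itself. The number of ancestors thus serves as a rank for topological orders. *)
Lemma card_at_lt i j : i \in at_ pa j -> (#|at_ pa i| < #|at_ pa j|)%N.
Proof.
move=> ij; apply/proper_card/properP; split.
  by apply/fintype.subsetP => k ki; exact: at_trans ki ij.
by exists i => //; exact: acyc.
Qed.

(* Induction along a topological order of the nodes of T outside T0. *)
Lemma ancestral_ind (T0 : {set V}) (Q : {set V} -> Prop) :
  ancestral T0 -> Q T0 ->
  (forall T j, ancestral T -> T0 \subset T -> j \notin T -> pa j \subset T ->
     Q T -> Q (j |: T)) ->
  forall T, ancestral T -> T0 \subset T -> Q T.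
Proof.
move=> aT0 QT0 QS T; move: {2}#|T| (leqnn #|T|) => m.
elim: m T => [|m IHm] T Tm aT T0T.
  move: Tm; rewrite leqn0 cards_eq0 => /eqP T_0; move: T0T.
  by rewrite T_0 finset.subset0 => /eqP <-.
have [TT0|] := boolP (T \subset T0).
  by have /eqP <- : T0 == T by rewrite finset.eqEsubset T0T.
case/subsetPn => j0 j0T j0T0.
(* A node of [T] outside [T0] with the most ancestors has no child in [T]: a child outside [T0]
   would have more ancestors, and one in [T0] would put the node in [T0]. Removing it therefore
   leaves an ancestral set. *)
case: (@arg_maxnP _ j0 (fun j => j \in T :\: T0) (fun j => #|at_ pa j|)).
  by rewrite inE j0T0.
move=> j; rewrite inE => /andP[jT0 jT] jmax.
rewrite -(finset.setD1K jT).
have paj : pa j \subset T :\ j.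
  apply/fintype.subsetP => i ij; rewrite !inE (ancestralP _ aT _ _ jT ij) andbT.
  by apply: contraNneq (acyc j) => ijE; rewrite -[X in X \in _]ijE; exact: pa_at.
have aTj : ancestral (T :\ j).
  apply/ancestralP => i k; rewrite !inE => /andP[kj kT] ik.
  rewrite (ancestralP _ aT _ _ kT ik) andbT; apply/negP => /eqP ijE; subst i.
  have [kT0|kT0] := boolP (k \in T0).
    by rewrite (ancestralP _ aT0 _ _ kT0 ik) in jT0.
  have := jmax k; rewrite inE kT0 kT => /(_ isT).
  by move/leq_gtF; rewrite card_at_lt// pa_at.
have T0j : T0 \subset T :\ j.
  apply/fintype.subsetP => i iT0; rewrite !inE (fintype.subsetP T0T)// andbT.
  by apply: contraNneq jT0 => <-.
apply: QS => //; first by rewrite !inE eqxx.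
apply: IHm => //; rewrite -ltnS (leq_trans _ Tm)//.
by rewrite [in X in (_ < X)%N](cardsD1 j) jT.
Qed.

Section Unaffected.
Variables (y : V) (I : {set V}).
Hypothesis yI : y \notin I.

(* The nodes that neither belong to ch(y) minus A_ nor descend from it. *)
Definition unaffected : {set V} :=
  [set b | ~~ [exists i in ch pa y :&: I, (i == b) || (i \in at_ pa b)]].

Lemma unaffectedP b :
  reflect (exists i, [/\ y \in pa i, i \in I & i = b \/ i \in at_ pa b])
    (b \notin unaffected).
Proof.
rewrite inE negbK; apply: (iffP exists_inP) => [[i]|[i [yi iI ib]]].
  move=> /setIP[]; rewrite inE => yi iI /orP[/eqP ib|ib]; exists i; split=> //.
    by left.
  by right.
exists i; first by rewrite !inE yi.
by case: ib => [->|->]; rewrite ?eqxx ?orbT.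
Qed.

Lemma ancestral_unaffected : ancestral unaffected.
Proof.
apply/ancestralP => i j jW ij; apply: contraLR jW.
move=> /unaffectedP[k [yk kI ki]]; apply/unaffectedP; exists k; split=> //.
right; case: ki => [->|ki]; first exact: pa_at.
exact: at_trans ki (pa_at ij).
Qed.

Lemma y_unaffected : y \in unaffected.
Proof.
rewrite -[_ \in _]negbK; apply/negP => /unaffectedP[i [yi iI [iy|iy]]].
  by rewrite iy (negPf yI) in iI.
by have := acyc y; rewrite (at_trans (pa_at yi) iy).
Qed.

(** The two exclusions in [A_], being intervened and having an intervened child of [y] as an
    ancestor, are the two ways in which a child of [y] can fail to be unaffected. *)
Lemma A_unaffectedE j : (j \in A_ pa y I) = (y \in pa j) && (j \in unaffected).
Proof.
rewrite !inE; case: (boolP (y \in pa j)) => //= yj.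
apply/andP/idP => [[jI /eqP jA]|]; last first.
  rewrite negb_exists_in => /forall_inP jW; split.
    by apply/negP => jI; have := jW j; rewrite !inE yj jI eqxx => /(_ isT).
  apply/eqP/setP => i; rewrite !inE; apply/negP => /andP[/andP[ij yi] iI].
  have := jW i; rewrite !inE yi iI => /(_ isT) /norP[_ /negP].
  by apply.
apply/negP => /exists_inP[i] /setIP[yi iI] /orP[/eqP ij|ij].
  by rewrite ij (negPf jI) in iI.
by have /setP/(_ i) := jA; rewrite inE finset.in_set0 inE ij yi iI.
Qed.

(** Parents of [y] and of nodes of [A_] are unaffected because the unaffected nodes form an
    ancestral set; acyclicity keeps [y] out of its own parents and children. *)
Lemma S_star_unaffected : S_star pa y I \subset unaffected :\ y.
Proof.
have aW := ancestral_unaffected; have yW := y_unaffected.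
apply/fintype.subsetP => i; rewrite in_setD1 => /setUP[/setUP[iy|]|/bigcupP[j]].
- rewrite (ancestralP _ aW _ _ yW iy) andbT.
  by apply: contraNneq (acyc y) => iyE; rewrite -[X in X \in _]iyE; exact: pa_at.
- rewrite A_unaffectedE => /andP[yi ->]; rewrite andbT.
  by apply: contraNneq (acyc y) => iyE; have := pa_at yi; rewrite iyE.
- rewrite A_unaffectedE => /andP[yj jW] /setD1P[-> ij].
  by rewrite (ancestralP _ aW _ _ jW ij).
Qed.

Lemma pa_sub_S_star : pa y \subset S_star pa y I.
Proof. by apply/fintype.subsetP => i iy; rewrite !finset.in_setU iy. Qed.

Lemma A_sub_S_star : A_ pa y I \subset S_star pa y I.
Proof. by apply/fintype.subsetP => i iy; rewrite !finset.in_setU iy orbT. Qed.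

Lemma paA_sub_S_star i j : j \in A_ pa y I -> i \in pa j -> i != y ->
  i \in S_star pa y I.
Proof.
move=> jA ij iy; rewrite !finset.in_setU; apply/orP; right.
by apply/bigcupP; exists j => //; rewrite in_setD1 iy.
Qed.

Lemma at_aug i b : i \in at_ pa b -> Some i \in at_ (aug_pa pa I) (Some b).
Proof.
rewrite !inE => /exists_inP[j jb /connectP[p ip jE]]; subst j.
apply/exists_inP; exists (Some (last i p)); first by rewrite inE.
apply/connectP; exists (map Some p); last by rewrite last_map.
rewrite path_map; apply: sub_path ip => k l kl.
by rewrite /= /edge inE.
Qed.

(** The only inner node of the path from the environment through an intervened child [i] to [y] is
    the collider [i], which is opened by [b]: either [i = b] or [b] descends from [i]. *)
Lemma unaffected_d_separated (S : {set V}) b : b \in S -> b \notin unaffected ->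
  ~ d_separated (aug_pa pa I) [set None] [set Some y] [set Some j | j in S].
Proof.
move=> bS /unaffectedP[i [yi iI ib]] /(_ None [:: Some i; Some y]).
have Ei : edge (aug_pa pa I) None (Some i) by rewrite /edge inE.
have yEi : edge (aug_pa pa I) (Some y) (Some i) by rewrite /edge inE.
have iy : i != y by apply: contraTneq iI => ->.
have iyu : uniq [:: None; Some i; Some y].
  by rewrite /= !inE /= andbT; exact: iy.
have pth : path (Defs.adjacent (aug_pa pa I)) None [:: Some i; Some y].
  by rewrite /= /Defs.adjacent Ei yEi orbT.
rewrite !set11 => /(_ isT pth iyu isT).
move=> /existsP[u] /existsP[v] /existsP[w] /andP[].
rewrite infix_consl => /orP[/= /and4P[/eqP-> /eqP-> /eqP-> _]|/size_infix//].
rewrite /blocked_at Ei yEi /= => /andP[iS /exists_inP[]].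
exists (Some b); first exact: imset_f.
case: ib iS => [->|ib _]; first by rewrite imset_f.
exact: at_aug.
Qed.

End Unaffected.
End Ancestors.

(** * Conditional independence of Y given S_star *)

Section Coordinates.
Context (R : realType) (d : nat).
Local Notation point := (d.+1.-tuple R).
Local Open Scope set_scope.
Implicit Types (S T : {set 'I_d.+1}) (z : point).

(* The coordinates outside S are replaced by the junk value 0, so that a
   function of proj S is a function of the coordinates in S. *)
Definition proj S z : point := [tuple if i \in S then tnth z i else 0 | i < d.+1].

Definition set_coord j (a : R) z : point :=
  [tuple if i == j then a else tnth z i | i < d.+1].

Lemma tnth_proj S z i : tnth (proj S z) i = if i \in S then tnth z i else 0.
Proof. by rewrite tnth_mktuple. Qed.

Lemma tnth_set_coord j a z i :
  tnth (set_coord j a z) i = if i == j then a else tnth z i.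
Proof. by rewrite tnth_mktuple. Qed.

Lemma proj_proj S T z : S \subset T -> proj S (proj T z) = proj S z.
Proof.
move=> /fintype.subsetP ST; apply: eq_from_tnth => i; rewrite !tnth_proj.
by case: ifP => // /ST ->.
Qed.

Lemma set_coord_proj j S z : set_coord j (tnth z j) (proj S z) = proj (j |: S) z.
Proof.
apply: eq_from_tnth => i; rewrite tnth_set_coord !tnth_proj in_setU1.
by case: eqP => // ->.
Qed.

Lemma measurable_proj S : measurable_fun setT (proj S).
Proof.
apply/measurable_fun_tnthP => i.
rewrite (_ : _ \o _ = if i \in S then (@tnth d.+1 R)^~ i else cst 0); last first.
  by apply/funext => z /=; rewrite tnth_proj; case: ifP.
by case: ifP => _; [exact: measurable_tnth|exact: measurable_cst].
Qed.

Lemma measurable_set_coord j :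
  measurable_fun setT (fun b : R * point => set_coord j b.1 b.2).
Proof.
apply/measurable_fun_tnthP => i.
rewrite (_ : _ \o _ = if i == j then fst else (@tnth d.+1 R)^~ i \o snd); last first.
  by apply/funext => z /=; rewrite tnth_set_coord; case: ifP.
case: ifP => _ //.
apply: (measurableT_comp _ measurable_snd); exact: measurable_tnth.
Qed.

End Coordinates.

(** A preimage splits into countably many pieces along the values of [e]; this handles assignments
    selected by the random label. *)
Lemma measurable_fun_nat_param d1 d2 (T1 : measurableType d1)
    (T2 : measurableType d2) (e : T1 -> nat) (g : nat -> T1 -> T2) :
  measurable_fun setT e -> (forall n, measurable_fun setT (g n)) ->
  measurable_fun setT (fun x => g (e x) x).
Proof.
move=> me mg _ B mB.
rewrite (_ : _ `&` _ = \bigcup_n (e @^-1` [set n] `&` g n @^-1` B)); last first.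
  apply/seteqP; split=> [x [_ Bx]|x [n _ [/= <- Bx]]]; last by split.
  by exists (e x).
apply: bigcup_measurable => n _; apply: measurableI.
- by rewrite -[X in measurable X]setTI; exact: me.
- by rewrite -[X in measurable X]setTI; exact: mg.
Qed.

Section Transfer.
Local Open Scope ereal_scope.
Context d (T : measurableType d) (R : realType) (P : probability T R).

(** Events of [k'] are events of [k], and [c(k)] can be recovered from [c'(k')], so [g] composed
    with [s] is again a version. *)
Lemma independent_given_transfer dY (Y : measurableType dY)
    dK (K : measurableType dK) dC (C : measurableType dC)
    dK' (K' : measurableType dK') dC' (C' : measurableType dC')
    (y : T -> Y) (k : T -> K) (c : K -> C) (k' : T -> K') (c' : K' -> C')
    (r : K -> K') (s : C' -> C) :
  measurable_fun setT r -> measurable_fun setT s ->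
  (forall x, k' x = r (k x)) -> (forall x, c (k x) = s (c' (k' x))) ->
  independent_given P y k c -> independent_given P y k' c'.
Proof.
move=> mr ms k'E cE ykc B mB; have [g [mg g0 Bg]] := ykc B mB.
exists (g \o s); split=> [|x|A mA]; [exact: measurableT_comp|exact: g0|].
have mrA : measurable (r @^-1` A).
  by rewrite -[X in measurable X]setTI; exact: mr.
transitivity (\int[P]_x ((\1_(r @^-1` A) (k x))%:E * ind R y B x)).
  by apply: eq_integral => x _; rewrite k'E.
by rewrite Bg//; apply: eq_integral => x _; rewrite /= -cE k'E.
Qed.

Lemma independent_of_comp dV (V : measurableType dV) (U : {mfun T >-> V})
    dK (K : measurableType dK) dK' (K' : measurableType dK')
    (k : T -> K) (k' : T -> K') (r : K -> K') :
  measurable_fun setT r -> (forall x, k' x = r (k x)) ->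
  independent_of P U k -> independent_of P U k'.
Proof.
move=> mr k'E kU A B mA mB; rewrite (_ : k' @^-1` A = k @^-1` (r @^-1` A)).
  by apply: kU => //; rewrite -[X in measurable X]setTI; exact: mr.
by apply/funext => x /=; rewrite k'E.
Qed.

End Transfer.

(** * Induction along growing ancestral sets *)

Section AncestralInduction.
Context (R : realType) (d : nat) (dU : 'I_d.+1 -> measure_display)
  (TU : forall j, measurableType (dU j)).
Context (pa : 'I_d.+1 -> {set 'I_d.+1}) (F : nat -> assignments R TU)
  (I : {set 'I_d.+1}) (y : 'I_d.+1).
Context dW (W : measurableType dW) (Q : probability W R)
  (N : forall j, {mfun W >-> TU j}) (e : W -> nat) (X : W -> d.+1.-tuple R).
Hypotheses (acyc : acyclic pa) (F_over : forall n, assignments_over pa (F n))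
  (F_I : forall n j, j \notin I -> @F n j = @F 0%N j) (yI : y \notin I)
  (me : measurable_fun setT e) (mX : measurable_fun setT X)
  (X_gen : generated F e N X).
Hypothesis noise_indep : forall (T : {set 'I_d.+1}) j, ancestral pa T ->
  j \notin T -> independent_of Q (N j) (fun w => (proj T (X w), e w)).

Local Notation W0 := (unaffected pa y I).
Local Notation S0 := (S_star pa y I).
Local Notation Y := (fun w => tnth (X w) y).
Local Notation known T := (fun w => (proj (T :\ y)%SET (X w), e w)).
(** The conditioning set is cut down to [T] because a node of [S_star] is available only once the
    growing set has reached it. *)
Local Notation sel T := (fun a : d.+1.-tuple R * nat => proj (S0 :&: T)%SET a.1).

Let mtnth j : measurable_fun setT (fun w => tnth (X w) j).
Proof. exact: (measurableT_comp (@measurable_tnth _ _ d.+1 j) mX). Qed.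

Let mknown T : measurable_fun setT (known T).
Proof.
apply: measurable_fun_pair => //.
exact: (measurableT_comp (@measurable_proj R d _) mX).
Qed.

Let msel T : measurable_fun setT (sel T).
Proof. by exact: (measurableT_comp (@measurable_proj R d _) measurable_fst). Qed.

Let F_eq n j (z z' : d.+1.-tuple R) u :
  {in pa j, forall i, tnth z i = tnth z' i} -> @F n j (z, u) = @F n j (z', u).
Proof. exact: (@F_over n j).2. Qed.

Let yS0 : y \notin S0.
Proof.
apply/negP => /(fintype.subsetP (S_star_unaffected acyc yI)).
by rewrite in_setD1 eqxx.
Qed.

Let selE T w : sel T (known T w) = proj (S0 :&: T)%SET (X w).
Proof.
rewrite /= proj_proj//; apply/fintype.subsetP => i /setIP[iS iT].
by rewrite in_setD1 iT andbT; apply: contraTneq iS => ->.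
Qed.

(** [y] is not intervened, its parents are in [S_star], and its noise is independent of its
    ancestors and of the label. *)
Let indep_base : independent_given Q Y
  (known (y |: at_ pa y)%SET) (sel (y |: at_ pa y)%SET).
Proof.
have yat : y \notin at_ pa y := acyc y.
apply: (independent_given_noise (mknown _) (msel _) (@F_over 0%N y).1).
- move=> w; rewrite X_gen F_I//; apply: F_eq => i iy /=.
  have iS : i \in S0 by rewrite (fintype.subsetP (pa_sub_S_star pa y I)).
  have iat : i \in at_ pa y := pa_at iy.
  have iNy : i != y by apply: contraTneq iat => ->.
  by rewrite !tnth_proj finset.in_setI iS in_setD1 in_setU1 iNy iat orbT.
- have := noise_indep (ancestral_at_set pa y) yat.
  by rewrite finset.setU1K.
Qed.

Let indep_step (T : {set 'I_d.+1}) j : ancestral pa T -> y \in T ->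
  j \notin T -> (pa j \subset T)%B -> j \in W0 ->
  independent_given Q Y (known T) (sel T) ->
  independent_given Q Y (known (j |: T)%SET) (sel (j |: T)%SET).
Proof.
move=> aT yT jT paj jW YT.
have jy : j != y by apply: contraNneq jT => ->.
(* [T] is ancestral and misses [j], so the noise of [j] is independent of all coordinates in [T],
   that of [y] included, and of the label. *)
have kyN : independent_of Q (N j) (fun w => (known T w, tnth (X w) y)).
  apply: (independent_of_comp _ _ (noise_indep aT jT)
    (r := fun b => ((proj (T :\ y)%SET b.1, b.2), tnth b.1 y))).
  - apply: measurable_fun_pair.
      apply: measurable_fun_pair => //.
      by exact: (measurableT_comp (@measurable_proj R d _) measurable_fst).
    by exact: (measurableT_comp (@measurable_tnth _ _ d.+1 y) measurable_fst).
  - by move=> w /=; rewrite proj_proj ?subsetDl// tnth_proj yT.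
have knownE w : known (j |: T)%SET w =
    (set_coord j (tnth (X w) j) (known T w).1, (known T w).2).
  rewrite /= set_coord_proj; congr (proj _ _, _); apply/setP => i.
  by rewrite !inE; case: (eqVneq i j) => [->|]//=; rewrite jy.
have mr : measurable_fun setT (fun b : (d.+1.-tuple R * nat) * R =>
    (set_coord j b.2 b.1.1, b.1.2)).
  apply: measurable_fun_pair; last exact: (measurableT_comp measurable_snd).
  have mp : measurable_fun setT (fun b : (d.+1.-tuple R * nat) * R => (b.2, b.1.1)).
    by apply: measurable_fun_pair => //; exact: (measurableT_comp measurable_fst).
  exact: (measurableT_comp (@measurable_set_coord R d j) mp).
have [yj|yj] := boolP (y \in pa j).
(* For a child of [y] the assignment does not depend on the label and reads, apart from [y], only
   coordinates in [S_star]; hence [f] takes the selected coordinates instead of all known ones. *)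
- have jA : j \in A_ pa y I by rewrite A_unaffectedE yj.
  have jI : j \notin I by move: jA; rewrite inE => /andP[_ /andP[]].
  have jS : j \in S0 := fintype.subsetP (A_sub_S_star pa y I) _ jA.
  pose f (b : d.+1.-tuple R * R * TU j) := @F 0%N j (set_coord y b.1.2 b.1.1, b.2).
  have mf : measurable_fun setT f.
    apply: (measurableT_comp (@F_over 0%N j).1); apply: measurable_fun_pair => //.
    have mp : measurable_fun setT (fun b : d.+1.-tuple R * R * TU j => (b.1.2, b.1.1)).
      apply: measurable_fun_pair; first exact: (measurableT_comp measurable_snd).
      exact: (measurableT_comp measurable_fst).
    exact: (measurableT_comp (@measurable_set_coord R d y) mp).
  have XE w : tnth (X w) j = f (sel T (known T w), tnth (X w) y, N j w).
    rewrite X_gen F_I//; apply: F_eq => i ij /=; rewrite tnth_set_coord.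
    case: eqVneq => [->//|iy]; rewrite !tnth_proj finset.in_setI in_setD1 iy.
    by rewrite (paA_sub_S_star jA ij iy) (fintype.subsetP paj _ ij).
  have := independent_given_child (mtnth y) (mknown T) (msel T) (mtnth j) mf XE kyN YT.
  apply: (independent_given_transfer mr
    (s := fun v => (proj (S0 :&: T)%SET v, tnth v j))) => //.
  + apply: measurable_fun_pair; [exact: measurable_proj|exact: measurable_tnth].
  + move=> w; rewrite !selE proj_proj ?finset.setIS ?finset.subsetUr//.
    by rewrite tnth_proj finset.in_setI jS setU11.
(* A node that is not a child of [y] may be intervened: the label that selects its assignment is one
   of the known variables. *)
- pose f (b : d.+1.-tuple R * nat * TU j) := @F b.1.2 j (b.1.1, b.2).
  have mf : measurable_fun setT f.
    apply: (measurable_fun_nat_param (g := fun n b => @F n j (b.1.1, b.2))) => [|n].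
      exact: (measurableT_comp measurable_snd).
    apply: (measurableT_comp (@F_over n j).1); apply: measurable_fun_pair => //.
    exact: (measurableT_comp measurable_fst).
  have XE w : tnth (X w) j = f (known T w, N j w).
    rewrite X_gen; apply: F_eq => i ij /=; rewrite tnth_proj in_setD1.
    rewrite (fintype.subsetP paj _ ij) andbT ifT//.
    by apply: contraNneq yj => <-.
  have := independent_given_nonchild (mtnth y) (mknown T) (msel T) mf XE kyN YT.
  (* If [j] is in [S_star], the conditioning set grows as well; the transfer allows this, as the old
     selection is a projection of the new one. *)
  apply: (independent_given_transfer mr (s := proj (S0 :&: T)%SET)) => //.
  + exact: measurable_proj.
  + move=> w; transitivity (proj (S0 :&: T)%SET (X w)); first exact: selE.
    by rewrite selE proj_proj ?finset.setIS ?finset.subsetUr.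
Qed.

Lemma independent_given_S_star :
  independent_given Q Y (known W0) (fun a => proj S0 a.1).
Proof.
have aW := ancestral_unaffected pa y I; have yW := y_unaffected acyc yI.
have -> : (fun a : d.+1.-tuple R * nat => proj S0 a.1) = sel W0.
  apply/funext => a; congr (proj _ _); apply/esym/finset.setIidPl.
  apply: fintype.subset_trans (S_star_unaffected acyc yI) _.
  exact: finset.subsetDl.
have atW : (y |: at_ pa y \subset W0)%SET.
  apply/fintype.subsetP => i /setU1P[->//|]; exact: ancestral_at.
(* The invariant is restricted to subsets of [W0] so that every node added is unaffected. *)
apply: (@ancestral_ind _ pa acyc (y |: at_ pa y)%SET
  (fun T => (T \subset W0)%B -> independent_given Q Y (known T) (sel T))) => //.
- apply: ancestralU1; first exact: ancestral_at_set.
  by apply/fintype.subsetP => i; exact: pa_at.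
- move=> T j aT T0T jT paj IH /fintype.subsetP jTW.
  apply: indep_step => //.
  + by rewrite (fintype.subsetP T0T)// setU11.
  + by rewrite jTW// setU11.
  + by apply: IH; apply/fintype.subsetP => i iT; rewrite jTW// in_setU1 iT orbT.
Qed.
End AncestralInduction.

(** * Independence of a noise from the variables it does not influence *)

Section NoiseIndependence.
Context (R : realType) (d : nat) (dU : 'I_d.+1 -> measure_display)
  (TU : forall j, measurableType (dU j)).
Context dO (Omega : measurableType dO) (P : probability Omega R)
  (U : forall j, {mfun Omega >-> TU j}) (n : nat) (s : n.+1.-tuple nat).
Hypothesis U_indep : mutually_independent P U.
Local Notation Q := (with_uniform P s).
Implicit Types (A : forall i, set (TU i)) (E : set nat).

Definition noise j (x : Omega * nat) : TU j := U j x.1.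

Lemma measurable_noise j : measurable_fun setT (@noise j).
Proof. exact: (measurableT_comp (measurable_funP (U j)) measurable_fst). Qed.

HB.instance Definition _ j :=
  isMeasurableFun.Build _ _ _ _ (@noise j) (@measurable_noise j).

Definition noise_cylinder A : set Omega := [set w | forall i, A i (U i w)].

Let measurable_cylinder A : (forall i, measurable (A i)) ->
  measurable (noise_cylinder A).
Proof.
move=> mA; rewrite (_ : noise_cylinder A = \bigcap_(i in setT) (U i @^-1` A i)).
  apply: fin_bigcap_measurable => // i _.
  by rewrite -[X in measurable X]setTI; exact: measurable_funP.
by apply/seteqP; split=> [w Aw i _|w Aw i]; apply: Aw.
Qed.

(* A pi-system that generates the sigma-algebra of the label and of the noises
   other than that of j. *)
Definition other_noise j : set (set (Omega * nat)) :=
  [set B | exists A E, [/\ forall i, measurable (A i), A j = setT &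
                           B = noise_cylinder A `*` E]].

Let other_noise_measurable j : other_noise j `<=` measurable.
Proof.
by move=> _ [A [E [mA _ ->]]]; apply: measurableX => //; exact: measurable_cylinder.
Qed.

Let other_noise_setI j : setI_closed (other_noise j).
Proof.
move=> _ _ [A [E [mA Aj ->]]] [B [F [mB Bj ->]]].
exists (fun i => A i `&` B i), (E `&` F); split.
- by move=> i; exact: measurableI.
- by rewrite Aj Bj setTI.
- rewrite -setXI; congr (_ `*` _).
  by apply/seteqP; split=> [w [Aw Bw] i|w ABw]; [split|split=> i; case: (ABw i)].
Qed.

Let other_noise_setT j : other_noise j setT.
Proof.
exists (fun=> setT), setT; split=> //; rewrite -setXTT; congr (_ `*` _).
by apply/seteqP; split.
Qed.

Lemma with_uniformX (B : set Omega) (E : set nat) : measurable B -> measurable E ->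
  (Q (B `*` E) = P B * uniform_law R s E)%E.
Proof. by move=> mB mE; exact: product_measure1E. Qed.

(** The event on the noise of [j] fills the factor that the cylinder leaves free at [j]; mutual
    independence then factorizes both cylinders. *)
Let indep_generator j B D : other_noise j B -> measurable D ->
  (Q (B `&` @noise j @^-1` D) = Q B * Q (@noise j @^-1` D))%E.
Proof.
move=> [A [E [mA Aj ->]]] mD.
pose A' := @dfwith _ (fun i => set (TU i)) A j D.
have mA' i : measurable (A' i).
  rewrite /A'; have [<-|ji] := eqVneq j i; first by rewrite dfwithin.
  by rewrite dfwithout.
have -> : noise_cylinder A `*` E `&` @noise j @^-1` D = noise_cylinder A' `*` E.
  apply/seteqP; split=> [[w e] [[/= Aw Ee] Dw]|[w e] [/= Aw Ee]].
    split=> // i /=; rewrite /A'; have [<-|ji] := eqVneq j i; first by rewrite dfwithin.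
    by rewrite dfwithout.
  split; last by have := Aw j; rewrite /A' dfwithin.
  split=> // i; have [<-|ji] := eqVneq j i; first by rewrite Aj.
  by have := Aw i; rewrite /A' dfwithout.
have -> : @noise j @^-1` D = U j @^-1` D `*` setT.
  by apply/seteqP; split=> [[w e] /=|[w e] /= []].
have mUD : measurable (U j @^-1` D).
  by rewrite -[X in measurable X]setTI; exact: measurable_funP.
rewrite !with_uniformX//; try exact: measurable_cylinder.
rewrite probability_setT mule1 -muleA [(uniform_law _ _ _ * _)%E]muleC muleA.
congr (_ * _)%E.
rewrite -[P (noise_cylinder A')]fineK ?fin_num_measure//; last first.
  exact: measurable_cylinder.
rewrite -[P (noise_cylinder A)]fineK ?fin_num_measure//; last first.
  exact: measurable_cylinder.
rewrite -[P (U j @^-1` D)]fineK ?fin_num_measure// -EFinM; congr (_%:E).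
rewrite !U_indep// (bigD1 j)//= [in RHS](bigD1 j)//= /A' dfwithin Aj.
rewrite preimage_setT probability_setT/= mul1r mulrC; congr (_ * _).
by apply: eq_bigr => i ij; rewrite dfwithout// eq_sym.
Qed.

(** For fixed [D] both sides are finite measures in [B] that agree on the pi-system
    [other_noise j]. *)
Let indep_sigma j B D : <<s other_noise j >> B -> measurable D ->
  (Q (B `&` @noise j @^-1` D) = Q B * Q (@noise j @^-1` D))%E.
Proof.
move=> sB mD.
have mND : measurable (@noise j @^-1` D).
  by rewrite -[X in measurable X]setTI; exact: measurable_noise.
pose r : {nonneg R} := NngNum (fine_ge0 (measure_ge0 Q (@noise j @^-1` D))).
have rE : (r%:num%:E = Q (@noise j @^-1` D))%E.
  by apply: fineK; exact: fin_num_measure.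
have cover : \bigcup_(i : nat) [set: Omega * nat] = setT by rewrite bigcup_const.
suff : mrestr Q mND B = mscale r Q B.
  by move=> h; rewrite muleC -rE; exact: h.
apply: (g_sigma_algebra_measure_unique (other_noise j) (@other_noise_measurable j)
  (fun=> setT) (fun=> other_noise_setT j) cover) => //.
- by move=> C GC; have := indep_generator GC mD; rewrite muleC -rE.
- move=> _; suff: (Q (setT `&` @noise j @^-1` D) < +oo)%E by [].
  by rewrite setTI -rE ltry.
Qed.

Lemma independent_of_noise j dK (K : measurableType dK) (k : Omega * nat -> K) :
  measurable_fun (setT : set (g_sigma_algebraType (other_noise j))) k ->
  independent_of Q (@noise j) k.
Proof.
move=> mk A D mA mD; apply: indep_sigma => //.
by rewrite -[_ @^-1` A]setTI; exact: mk.
Qed.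

Section Generated.
Context (pa : 'I_d.+1 -> {set 'I_d.+1}) (F : nat -> assignments R TU)
  (X : Omega * nat -> d.+1.-tuple R).
Hypotheses (acyc : acyclic pa) (F_over : forall n, assignments_over pa (F n))
  (X_gen : generated F snd noise X).

(** Solving the structural equations along [T], which contains all its ancestors but not [j], only
    calls on the label and on noises other than that of [j]. *)
Lemma noise_independent (T : {set 'I_d.+1}) j : ancestral pa T -> j \notin T ->
  independent_of Q (@noise j) (fun w => (proj T (X w), w.2)).
Proof.
move=> aT jT; apply: independent_of_noise.
set G := g_sigma_algebraType (other_noise j).
have me : measurable_fun (setT : set G) (snd : Omega * nat -> nat).
  move=> _ E mE; rewrite setTI; apply: sub_sigma_algebra.
  exists (fun=> setT), E; split=> //.
  by apply/seteqP; split=> [[w e]|[w e] []].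
have mN i : i != j -> measurable_fun (setT : set G) (@noise i).
  move=> ij _ D mD; rewrite setTI; apply: sub_sigma_algebra.
  exists (@dfwith _ (fun i => set (TU i)) (fun=> setT) i D), setT; split.
  - by move=> l; have [<-|il] := eqVneq i l; [rewrite dfwithin|rewrite dfwithout].
  - by rewrite dfwithout.
  - apply/seteqP; split=> [[w e] Dw|[w e] [/= + _]].
      split=> // l /=; have [<-|il] := eqVneq i l; first by rewrite dfwithin.
      by rewrite dfwithout.
    by move/(_ i); rewrite dfwithin.
have mproj (S : {set 'I_d.+1}) :
    (forall i, i \in S -> measurable_fun (setT : set G) (fun w => tnth (X w) i)) ->
    measurable_fun (setT : set G) (fun w => proj S (X w)).
  move=> mS; apply/measurable_fun_tnthP => i.
  rewrite (_ : _ \o _ = if i \in S then (fun w => tnth (X w) i) else cst 0).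
    by case: ifP => [/mS//|_]; exact: measurable_cst.
  by apply/funext => w /=; rewrite tnth_proj; case: ifP.
have mX i : i \in T -> measurable_fun (setT : set G) (fun w => tnth (X w) i).
  (* Strong induction on the number of ancestors, which is smaller for every parent. *)
  move: {2}#|at_ pa i|.+1 (ltnSn #|at_ pa i|) => m.
  elim: m i => // m IHm i im iT.
  rewrite (_ : (fun w => _) = fun w => @F w.2 i (proj (pa i) (X w), noise i w)).
    have mpN : measurable_fun (setT : set G) (fun w => (proj (pa i) (X w), @noise i w)).
      apply: measurable_fun_pair; last by apply: mN; apply: contraNneq jT => <-.
      apply: mproj => l li; apply: IHm; last exact: (ancestralP _ _ aT _ _ iT li).
      by rewrite -ltnS; apply: leq_trans im; rewrite ltnS card_at_lt// pa_at.
    apply: (measurable_fun_nat_param (T1 := G)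
      (g := fun n w => @F n i (proj (pa i) (X w), noise i w))) => // l.
    exact: (measurableT_comp (@F_over l i).1 mpN).
  apply/funext => w; rewrite X_gen; apply: (@F_over _ i).2 => l li /=.
  by rewrite tnth_proj li.
by apply: measurable_fun_pair => //; exact: mproj.
Qed.

End Generated.
End NoiseIndependence.

(** * Regression functions *)

Section UniformLabel.
Local Open Scope ereal_scope.
Context (R : realType) dO (Omega : measurableType dO) (P : probability Omega R)
  (n : nat) (s : n.+1.-tuple nat).
Local Notation Q := (with_uniform P s).
Local Notation label i := (nth 0%N s i).
Local Notation weight := ((n.+1%:R^-1)%:E : \bar R).

Let weight_gt0 : 0 < weight.
Proof. by rewrite lte_fin invr_gt0. Qed.

Lemma measurable_section d' (T' : measurableType d') (h : Omega * nat -> T') e :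
  measurable_fun setT h -> measurable_fun setT (fun w => h (w, e)).
Proof. by move=> mh; exact: (measurableT_comp mh (measurable_pair2 e)). Qed.

Lemma integral_with_uniform (h : Omega * nat -> \bar R) :
  measurable_fun setT h -> (forall x, 0 <= h x) ->
  \int[Q]_x h x = \sum_(i < n.+1) (weight * \int[P]_w h (w, label i)).
Proof.
move=> mh h0; rewrite [LHS](fubini_tonelli1 h)// /fubini_F /=.
have mhl i : measurable_fun setT (fun w => h (w, label i)).
  exact: (measurable_section (label i) mh).
rewrite (eq_bigr (fun i : 'I_n.+1 => \int[P]_w (weight * h (w, label i)))); last first.
  by move=> i _; rewrite ge0_integralZl.
rewrite -ge0_integral_sum//; last 2 first.
- by move=> i; apply: measurable_funeM; exact: mhl.
- by move=> i w _; rewrite mule_ge0// ltW.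
apply: eq_integral => w _.
have mhw : measurable_fun setT (fun e => h (w, e)).
  exact: (measurableT_comp mh (measurable_pair1 w)).
rewrite [LHS]ge0_integral_measure_sum//; apply: eq_bigr => i _.
rewrite ge0_integral_mscale//=; congr (_ * _).
by rewrite integral_dirac// diracT mul1e.
Qed.

Lemma integral_with_uniform_label (h : Omega * nat -> \bar R) (i : 'I_n.+1) :
  uniq s -> measurable_fun setT h -> (forall x, 0 <= h x) ->
  \int[Q]_x ((\1_[set label i] x.2)%:E * h x) =
  weight * \int[P]_w h (w, label i).
Proof.
move=> us mh h0.
rewrite integral_with_uniform; first last.
- by move=> x; rewrite mule_ge0// eindic_ge0.
- apply: emeasurable_funM => //.
  exact: (measurableT_comp (measurable_eindic _) measurable_snd).
rewrite (bigD1 i)//= [X in _ + X]big1 ?adde0; last first.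
  move=> j ji; rewrite integral0_eq ?mule0// => w _.
  rewrite indicE memNset ?mul0e//= => /eqP.
  by rewrite nth_uniq ?size_tuple// (inj_eq val_inj) (negPf ji).
congr (_ * _); apply: eq_integral => w _.
by rewrite indicE mem_set ?mul1e.
Qed.

Lemma with_uniform_integrable (h : Omega * nat -> \bar R) :
  measurable_fun setT h -> (forall x, 0 <= h x) ->
  (forall i : 'I_n.+1, \int[P]_w h (w, label i) < +oo) ->
  Q.-integrable setT h.
Proof.
move=> mh h0 hoo; apply: ge0_integrable => //.
rewrite integral_with_uniform//; apply: lte_sum_pinfty => i _.
by apply: lte_mul_pinfty => //; exact: ltW.
Qed.

(** The mixture identity is tested on the event of [A] times a single label, and the positive weight
    of that label cancels. As [g] does not see the label, the same [g] is obtained in every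
    environment. *)
Lemma cond_mean_label dK (K : measurableType dK) dC (C : measurableType dC)
    (w : Omega * nat -> \bar R) (k : Omega * nat -> K) (c : K -> C) g
    (i : 'I_n.+1) : uniq s ->
  measurable_fun setT k -> measurable_fun setT c ->
  measurable_fun setT w -> (forall x, 0 <= w x) ->
  cond_mean Q w (fun x => (k x, x.2)) (c \o fst) g ->
  cond_mean P (fun o => w (o, label i)) (fun o => k (o, label i)) c g.
Proof.
move=> us mk mc mw w0 [mg g0 wg]; split=> // A mA.
have Q_label (v : Omega * nat -> \bar R) : measurable_fun setT v ->
    (forall x, 0 <= v x) ->
    \int[Q]_x ((\1_(A `*` [set label i]) (k x, x.2))%:E * v x) =
    weight * \int[P]_o ((\1_A (k (o, label i)))%:E * v (o, label i)).
  move=> mv v0.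
  rewrite -(@integral_with_uniform_label (fun x => (\1_A (k x))%:E * v x))//.
  - by apply: eq_integral => x _; rewrite eindicX muleCA muleA.
  - apply: emeasurable_funM => //.
    exact: (measurableT_comp (measurable_eindic mA) mk).
  - by move=> x; rewrite mule_ge0// eindic_ge0.
have mgk : measurable_fun setT (fun x => g (c (k x))).
  by apply: (measurableT_comp mg); exact: (measurableT_comp mc).
have mAl : measurable (A `*` [set label i]) by exact: measurableX.
have := wg _ mAl; rewrite !Q_label// => /(congr1 (mule n.+1%:R%:E)).
by rewrite !muleA -EFinM mulfV ?pnatr_eq0// !mul1e.
Qed.

End UniformLabel.

Section RegressionFunction.
Local Open Scope ereal_scope.
Context d (T : measurableType d) (R : realType) (P : probability T R).

(** [Y] is dominated in absolute value by [1 + Y ^+ 2], which is integrable under a probability. *)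
Lemma square_integrable (Y : T -> R) : measurable_fun setT Y ->
  \int[P]_x (Y x ^+ 2)%:E < +oo -> P.-integrable setT (EFin \o Y).
Proof.
move=> mY Y2; have iY2 : P.-integrable setT (fun x => (Y x ^+ 2)%:E).
  apply: ge0_integrable => // [|x]; last by rewrite lee_fin sqr_ge0.
  by apply/measurable_EFinP; exact: measurable_funX.
have i1 : P.-integrable setT (cst 1) by exact: finite_measure_integrable_cst.
apply: (le_integrable _ _ _ (integrableD _ i1 iY2)) => //.
  exact/measurable_EFinP.
move=> x _ /=; rewrite lee_fin [leRHS]ger0_norm ?addr_ge0 ?sqr_ge0// ler_norml.
by apply/andP; split; nra.
Qed.

(** The version is integrable, hence a.e. finite, so [fine] alters it on a null set only. *)
Lemma cond_mean_fine dK (K : measurableType dK) dC (C : measurableType dC)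
    (w : T -> \bar R) (k : T -> K) (c : K -> C) g :
  measurable_fun setT k -> measurable_fun setT c ->
  (forall x, 0 <= w x) -> P.-integrable setT w -> cond_mean P w k c g ->
  cond_mean P w k c (fun a => (fine (g a))%:E).
Proof.
move=> mk mc w0 iw wg; have ig := cond_mean_integrable mk mc w0 iw wg.
have [mg g0 Hg] := wg.
have mfg : measurable_fun setT (fun a => (fine (g a))%:E).
  by apply/measurable_EFinP; exact: (measurableT_comp (fine_measurable measurableT) mg).
split=> // [a|A mA]; first by rewrite lee_fin fine_ge0.
have mA1 : measurable_fun setT (fun x => (\1_A (k x))%:E : \bar R).
  exact: (measurableT_comp (measurable_eindic mA) mk).
have mck : measurable_fun setT (fun x => c (k x)) by exact: (measurableT_comp mc mk).
rewrite Hg//; apply: ae_eq_integral => //.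
- by apply: emeasurable_funM => //; exact: (measurableT_comp mg mck).
- by apply: emeasurable_funM => //; exact: (measurableT_comp mfg mck).
- have := integrable_ae measurableT ig.
  by apply: filterS => x /(_ Logic.I) gfin _; rewrite fineK.
Qed.

(* A version of E[Y | k] that is a function of c(k). *)
Definition mean_function dK (K : measurableType dK) dC (C : measurableType dC)
    (Y : T -> R) (k : T -> K) (c : K -> C) (m : C -> R) : Prop :=
  [/\ measurable_fun setT m, P.-integrable setT (fun x => (m (c (k x)))%:E) &
      forall A, measurable A -> \int[P]_(x in k @^-1` A) (m (c (k x)))%:E =
                                \int[P]_(x in k @^-1` A) (Y x)%:E].

Lemma mean_function_posneg dK (K : measurableType dK) dC (C : measurableType dC)
    (Y : T -> R) (k : T -> K) (c : K -> C) (p q : C -> R) :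
  measurable_fun setT k -> measurable_fun setT c ->
  P.-integrable setT (EFin \o Y) ->
  cond_mean P ((EFin \o Y)^\+) k c (EFin \o p) ->
  cond_mean P ((EFin \o Y)^\-) k c (EFin \o q) ->
  mean_function Y k c (fun a => p a - q a)%R.
Proof.
move=> mk mc iY Yp Yq.
have iYp := integrable_funepos measurableT iY.
have iYq := integrable_funeneg measurableT iY.
have ip := cond_mean_integrable mk mc (funepos_ge0 _) iYp Yp.
have iq := cond_mean_integrable mk mc (funeneg_ge0 _) iYq Yq.
have [mp p0 Hp] := Yp; have [mq q0 Hq] := Yq.
split.
- by apply: measurable_funB; apply/measurable_EFinP.
- by under eq_fun do rewrite EFinB; exact: integrableB.
- move=> A mA; have mkA : measurable (k @^-1` A).
    by rewrite -[X in measurable X]setTI; exact: mk.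
  under eq_integral do rewrite EFinB.
  have ipA : P.-integrable (k @^-1` A) (fun x => (p (c (k x)))%:E).
    exact: integrableS ip.
  have iqA : P.-integrable (k @^-1` A) (fun x => (q (c (k x)))%:E).
    exact: integrableS iq.
  rewrite integralB// [RHS]integralE !integral_preimageE.
  by rewrite -[X in X - _ = _]Hp// -[X in _ - X = _]Hq.
Qed.

End RegressionFunction.

(** * Versions of the regressions and their uniqueness *)

Section Regressions.
Context (R : realType) (d : nat).
Local Notation point := (d.+1.-tuple R).
Implicit Types (S : {set 'I_d.+1}) (mu : probability point R).

Lemma sigma_of_measurable S (A : set point) :
  sigma_of (@coordinate R d) S A -> measurable A.
Proof.
apply: smallest_sub; first exact: sigma_algebra_measurable.
by move=> _ [i _ [B mB <-]]; exact: measurable_tnth.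
Qed.

(** The sets invariant under [proj S] form a sigma-algebra containing the generators. With
    [proj_sigma_of], the events of the coordinates in [S] are exactly the preimages under
    [proj S]. *)
Lemma sigma_of_proj S (A : set point) :
  sigma_of (@coordinate R d) S A -> proj S @^-1` A = A.
Proof.
pose Inv := [set A : set point | proj S @^-1` A = A].
apply: (@smallest_sub _ (sigma_algebra setT) _ Inv).
  split=> [|B BI|F FI]; rewrite /Inv /=.
  - by rewrite preimage_set0.
  - by rewrite setTD -preimage_setC BI.
  - by rewrite preimage_bigcup; apply: eq_bigcupr => i _; exact: FI.
move=> _ [i /= iS [B mB <-]]; rewrite /Inv /= !setTI.
by apply/seteqP; split=> z; rewrite /= /coordinate tnth_proj iS.
Qed.

Lemma proj_sigma_of S (A : set point) : measurable A ->
  sigma_of (@coordinate R d) S (proj S @^-1` A).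
Proof.
move=> mA; rewrite /sigma_of; set G := \bigcup_(i in [set` S]) _.
have mproj : measurable_fun (setT : set (g_sigma_algebraType G)) (proj S).
  apply/measurable_fun_tnthP => i.
  rewrite (_ : _ \o _ = if i \in S then (fun z => tnth z i) else cst 0).
    case: ifP => iS; last exact: measurable_cst.
    by move=> _ B mB; apply: sub_sigma_algebra; exists i => //; exists B.
  by apply/funext => w /=; rewrite tnth_proj; case: ifP.
by have := mproj measurableT A mA; rewrite setTI.
Qed.

Lemma is_regression_proj mu S m z : is_regression mu S m -> m (proj S z) = m z.
Proof.
move=> [mS _ _]; have := sigma_of_proj (mS [set m z] (measurable_set1 _)).
by move=> /seteqP[_ /(_ z)]; exact.
Qed.

Lemma is_regression_measurable mu S m :
  is_regression mu S m -> measurable_fun setT m.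
Proof.
move=> [mS _ _] _ B mB; rewrite setTI; exact: (sigma_of_measurable (mS B mB)).
Qed.

Lemma measurable_neq d' (T : measurableType d') (f g : T -> R) :
  measurable_fun setT f -> measurable_fun setT g ->
  measurable [set z | f z <> g z].
Proof.
move=> mf mg; rewrite (_ : [set z | _] = ~` ((f \- g) @^-1` [set 0])); last first.
  apply/seteqP; split=> z /=; first by move=> fg /eqP; rewrite subr_eq0 => /eqP.
  by move=> fg /eqP fgz; apply: fg; apply/eqP; rewrite subr_eq0.
apply: measurableC; rewrite -[X in measurable X]setTI.
by apply: measurable_funB => //; exact: measurable_set1.
Qed.

Lemma null_neq_trans d' (T : measurableType d') (P : probability T R)
    (f g h : T -> R) : measurable_fun setT f -> measurable_fun setT g ->
  measurable_fun setT h ->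
  P [set z | f z <> g z] = 0%E -> P [set z | g z <> h z] = 0%E ->
  P [set z | f z <> h z] = 0%E.
Proof.
move=> mf mg mh fg gh; apply/eqP; rewrite -measure_le0 -fg.
rewrite -(measureU0 (measurable_neq mf mg) (measurable_neq mg mh) gh).
apply: le_measure; rewrite ?inE.
- exact: measurable_neq.
- by apply: measurableU; exact: measurable_neq.
- move=> z /= fh; have [fgz|] := pselect (f z = g z); last by left.
  by right; rewrite -fgz.
Qed.

(** Both versions factor through [proj S]. Under the law of [proj S] they have equal integrals over
    all measurable sets, hence agree a.e., and the null set is pulled back along [proj S]. *)
Lemma is_regression_unique mu S m m' :
  is_regression mu S m -> is_regression mu S m' ->
  mu [set z | m z <> m' z] = 0%E.
Proof.
move=> rm rm'; have mm := is_regression_measurable rm.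
have mm' := is_regression_measurable rm'.
pose pS : {mfun point >-> point} :=
  HB.pack (proj S) (isMeasurableFun.Build _ _ _ _ _ (@measurable_proj R d S)).
have int_proj w : is_regression mu S w ->
    mu.-integrable setT ((EFin \o w) \o proj S).
  move=> rw; have [_ iw _] := rw; apply: eq_integrable iw => // z _ /=.
  by rewrite (is_regression_proj _ rw).
have ae : ae_eq (distribution mu pS) setT (EFin \o m) (EFin \o m').
  apply: integral_ae_eq => //.
  - by apply: integrable_pushforward => //; [exact/measurable_EFinP|exact: int_proj].
  - exact/measurable_EFinP.
  - move=> E _ mE.
    have mpE : measurable (proj S @^-1` E).
      by rewrite -[X in measurable X]setTI; exact: measurable_proj.
    have intE w : is_regression mu S w -> measurable_fun setT w ->
        (\int[distribution mu pS]_(x in E) (EFin \o w) x =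
         \int[mu]_(x in proj S @^-1` E) (coordinate Ynode x)%:E)%E.
      move=> rw mw; rewrite integral_pushforward//; first last.
      - by apply: integrableS (int_proj _ rw).
      - exact/measurable_EFinP.
      have [_ _ <-] := rw; last exact: proj_sigma_of.
      by apply: eq_integral => z _ /=; rewrite (is_regression_proj _ rw).
    by rewrite !intE.
have mne := measurable_neq mm mm'.
have neE : [set z | m z <> m' z] = proj S @^-1` [set z | m z <> m' z].
  apply/seteqP; split=> z /=;
  by rewrite (is_regression_proj _ rm) (is_regression_proj _ rm').
have [N [mN N0 subN]] := ae.
apply/eqP; rewrite -measure_le0 -N0 [in leLHS]neE.
have mpN : measurable (proj S @^-1` N).
  by rewrite -[X in measurable X]setTI; exact: measurable_proj.
apply: le_measure; rewrite ?inE -?neE//.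
rewrite [X in X `<=` _]neE => z /= mz; apply: subN => /= /(_ Logic.I) [].
exact: mz.
Qed.

(** The existence of one version excludes the default value of [xget]. *)
Lemma regressionP mu S m : is_regression mu S m ->
  is_regression mu S (regression mu S).
Proof. by move=> rm; apply: xgetPex; exists m. Qed.

(** The version is a function of the coordinates in [S0], and events of [S] are events of [W]; so
    one mean function given [W] is a regression for every intermediate [S]. *)
Lemma mean_function_regression d' (T : measurableType d') (P : probability T R)
    (Z : {RV P >-> point}) (S0 S W : {set 'I_d.+1}) (m : point -> R) :
  S0 \subset S -> S \subset W ->
  P.-integrable setT (fun x => (tnth (Z x) Ynode)%:E) ->
  mean_function P (fun x => tnth (Z x) Ynode) (fun x => proj W (Z x)) (proj S0) m ->
  is_regression (distribution P Z) S (m \o proj S0).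
Proof.
move=> S0S SW iY [mm im mE].
have mZ : measurable_fun setT Z by exact: measurable_funP.
have mmS : measurable_fun setT (m \o proj S0).
  by apply: (measurableT_comp mm); exact: measurable_proj.
have projE x : proj S0 (proj W (Z x)) = proj S0 (Z x).
  by rewrite proj_proj//; exact: fintype.subset_trans SW.
have im' : P.-integrable setT ((EFin \o (m \o proj S0)) \o Z).
  by apply: eq_integrable im => // x _ /=; rewrite projE.
split.
- move=> B mB; rewrite (_ : _ @^-1` B = proj S @^-1` ((m \o proj S0) @^-1` B)).
    by apply: proj_sigma_of; rewrite -[X in measurable X]setTI; exact: mmS.
  by apply/seteqP; split=> z /=; rewrite proj_proj.
- by apply: integrable_pushforward => //; exact/measurable_EFinP.
- move=> A sA; have mA := sigma_of_measurable sA; have pA := sigma_of_proj sA.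
  have mZA : measurable (Z @^-1` A) by rewrite -[X in measurable X]setTI; exact: mZ.
  have AE : Z @^-1` A = (fun x => proj W (Z x)) @^-1` A.
    rewrite -pA; apply/seteqP; split=> x /=; by rewrite proj_proj.
  rewrite (integral_pushforward mZ (f := EFin \o (m \o proj S0)))//; last 2 first.
  - exact/measurable_EFinP.
  - exact: integrableS im'.
  rewrite (integral_pushforward mZ (f := EFin \o coordinate Ynode))//; last 2 first.
  - by apply/measurable_EFinP; exact: measurable_tnth.
  - exact: integrableS iY.
  transitivity (\int[P]_(x in (fun x => proj W (Z x)) @^-1` A)
    (m (proj S0 (proj W (Z x))))%:E)%E.
    by rewrite AE; apply: eq_integral => x _ /=; rewrite projE.
  by rewrite mE// -AE.
Qed.

End Regressions.

(** Induction on the number of ancestors: in an acyclic graph the noises determine the solution.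
    This identifies the augmented variables at a fixed label with those of the corresponding
    environment. *)
Lemma generated_unique (R : realType) (d : nat) (dU : 'I_d.+1 -> measure_display)
    (TU : forall j, measurableType (dU j)) (pa : 'I_d.+1 -> {set 'I_d.+1})
    (F : assignments R TU) (u : forall j, TU j) (z z' : d.+1.-tuple R) :
  acyclic pa -> assignments_over pa F ->
  (forall j, tnth z j = F j (z, u j)) -> (forall j, tnth z' j = F j (z', u j)) ->
  z = z'.
Proof.
move=> acyc F_over zE z'E; apply: eq_from_tnth => j.
move: {2}#|at_ pa j|.+1 (ltnSn #|at_ pa j|) => m.
elim: m j => // m IHm j jm; rewrite zE z'E; apply: (F_over j).2 => i ij.
by apply: IHm; rewrite -ltnS; apply: leq_trans jm; rewrite ltnS card_at_lt// pa_at.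
Qed.

(** * Transferability and maximality of [S_star] *)

Theorem proposition3p2 (R : realType) (d n : nat)
  (* exogenous variables *)
  (dO : measure_display) (Omega : measurableType dO) (P : probability Omega R)
  (dU : 'I_d.+1 -> measure_display) (TU : forall j, measurableType (dU j))
  (U : forall j, {mfun Omega >-> TU j})
  (U_indep : mutually_independent P U)
  (* environments 0, ..., n and the new environment t *)
  (pa : 'I_d.+1 -> {set 'I_d.+1}) (pa_acyclic : acyclic pa)
  (f : nat -> assignments R TU)
  (f_over : forall e, assignments_over pa (f e))
  (f_Y : forall e, (e < n.+1)%N -> f e Ynode = f 0%N Ynode)
  (t : nat) (t_new : (n < t)%N)
  (f_t : forall j, j \notin interventions f n.+1 -> f t j = f 0%N j)
  (* the variables (X^(e), Y^(e)) *)
  (Z : nat -> {RV P >-> (d.+1.-tuple R : measurableType _)})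
  (Z_gen : forall e, generated f (cst e) U (Z e))
  (Y_L2 : forall e, (e < n.+1)%N \/ e = t ->
     (\int[P]_w (tnth (Z e w) Ynode ^+ 2)%:E < +oo)%E)
  (* the variables (X, Y) of the augmented models: E is uniform on {0, ..., n}
     in the first one and uniform on {0, t} in the second one *)
  (Zt : {RV (with_uniform P (iota_tuple n.+1 0)) >->
             (d.+1.-tuple R : measurableType _)})
  (Zt_gen : generated (augmented f (interventions f n.+1)) snd
              (fun j x => U j x.1) Zt)
  (Zb : {RV (with_uniform P [tuple 0%N; t]) >->
             (d.+1.-tuple R : measurableType _)})
  (Zb_gen : generated (augmented f (interventions f n.+1)) snd
              (fun j x => U j x.1) Zb) :
  let I := interventions f n.+1 in
  let mu e := distribution P (Z e) in
  let S0 := S_star pa Ynode I in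
  let Pt := with_uniform P (iota_tuple n.+1 0) in
  let Pb := with_uniform P [tuple 0%N; t] in
  regressions_agree (mu 0%N) (mu t) S0 /\
  ((* (a) *)
   (forall S : {set 'I_d.+1}, Ynode \notin S ->
      (exists2 j, j \in S & Ynode \in at_ pa j) ->
      ~ env_indep Pt Zt S ->
      exists e e', [/\ (e < n.+1)%N, (e' < n.+1)%N
                     & regressions_differ (mu e) (mu e') S]) ->
   (* (b) *)
   faithful Pt (with_env Zt) (aug_pa pa I) ->
   (* (c) *)
   (forall S : {set 'I_d.+1}, Ynode \notin S ->
      (exists2 j, j \in S & Ynode \in at_ pa j) ->
      ~ env_indep Pb Zb S ->
      regressions_differ (mu 0%N) (mu t) S) ->
   faithful Pb (with_env Zb) (aug_pa pa I) ->
   forall S : {set 'I_d.+1}, Ynode \notin S ->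
     (0 < mu t [set x | regression (mu t) (S0 :|: S)%SET x <>
                        regression (mu t) S0 x])%E ->
     regressions_differ (mu 0%N) (mu t) S).
Proof.
move=> I mu S0 Pt Pb; set y := Ynode; pose W := unaffected pa y I.
have yI : y \notin I by rewrite inE eqxx.
pose F := augmented f I.
have F_over e : assignments_over pa (F e).
  by move=> j; rewrite /F /augmented; case: ifP => _; exact: f_over.
have F_I e j : j \notin I -> F e j = F 0%N j.
  by move=> jI; rewrite /F /augmented (negPf jI).
have t0 : (0 == t) = false by apply/eqP => t0; rewrite -t0 in t_new.
(* Off [I] the assignments of [t] are those of 0, so at the labels 0 and [t] the augmented equations
   are the original ones. *)
have FE e : e = 0%N \/ e = t -> F e = f e.
  move=> e0t; apply: functional_extensionality_dep => j; rewrite /F /augmented.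
  case: ifPn => // jI; case: e0t => ->//; exact/esym/f_t.
have ZbE e w : e = 0%N \/ e = t -> Zb (w, e) = Z e w.
  move=> e0t; apply: (@generated_unique _ _ _ _ pa (f e) (fun j => U j w)) => // j.
  - by rewrite Zb_gen -/F /= (FE _ e0t).
  - by rewrite Z_gen.
have mZb : measurable_fun setT Zb by exact: measurable_funP.
have mtnthZb j : measurable_fun setT (fun x => tnth (Zb x) j).
  exact: (measurableT_comp (@measurable_tnth _ _ d.+1 j) mZb).
have aW : ancestral pa W := ancestral_unaffected pa y I.
have S0W : (S0 \subset W :\ y)%SET := S_star_unaffected pa_acyclic yI.
have YS0 := independent_given_S_star (Q := Pb) (N := fun j => noise U j) pa_acyclic
  F_over F_I yI measurable_snd mZb Zb_gen
  (noise_independent _ U_indep pa_acyclic F_over Zb_gen).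
have iY e : e = 0%N \/ e = t -> P.-integrable setT (EFin \o (fun w => tnth (Z e w) y)).
  move=> e0t; apply: square_integrable.
    exact: (measurableT_comp (@measurable_tnth _ _ d.+1 y) (measurable_funP (Z e))).
  by apply: Y_L2; case: e0t => ->; [left|right].
have label_e (i : 'I_2) : nth 0%N [:: 0%N; t] i = 0%N \/ nth 0%N [:: 0%N; t] i = t.
  by case: i => [[|[|]]]//= _; [left|right].
pose Yb x := tnth (Zb x) y.
have iYb : Pb.-integrable setT (EFin \o Yb).
  apply/integrableP; split; first by apply/measurable_EFinP; exact: mtnthZb.
  apply: (@ge0_integrable_lty _ _ _ Pb (fun x => `|(Yb x)%:E|)%E) => //.
  apply: with_uniform_integrable => // [|i].
    by apply: measurableT_comp => //; apply/measurable_EFinP; exact: mtnthZb.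
  have /integrableP[_] := iY _ (label_e i).
  by congr (_ < _)%E; apply: eq_integral => w _; rewrite /Yb ZbE.
have mK : measurable_fun setT (fun x => (proj (W :\ y)%SET (Zb x), x.2)).
  apply: measurable_fun_pair => //.
  exact: (measurableT_comp (@measurable_proj R d _) mZb).
have mC : measurable_fun setT (fun a : d.+1.-tuple R * nat => proj S0 a.1).
  exact: (measurableT_comp (@measurable_proj R d _) measurable_fst).
(* Given the unaffected coordinates and the label, the mean of [g(Y)] under the mixture depends on
   the coordinates in [S0] only, so one [p] serves both environments. *)
have mean (g : R -> \bar R) : measurable_fun setT g -> (forall a, (0 <= g a)%E) ->
    Pb.-integrable setT (fun x => g (Yb x)) -> exists p : d.+1.-tuple R -> R,
    forall e, e = 0%N \/ e = t -> cond_mean P (fun w => g (tnth (Z e w) y))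
      (fun w => proj (W :\ y)%SET (Z e w)) (proj S0) (EFin \o p).
  move=> mg g0 ig.
  have [q Hq] := independent_given_mean (mtnthZb y) mK mC YS0
    (h := g \o fst) (measurableT_comp mg measurable_fst) (fun=> g0 _) ig.
  have {}Hq := cond_mean_fine mK mC (fun=> g0 _) ig Hq.
  exists (fine \o q) => e e0t.
  have [i ei] : exists i : 'I_2, e = nth 0%N [:: 0%N; t] i.
    by case: e0t => ->; [exists ord0|exists ord_max].
  have mkb : measurable_fun setT (fun x => proj (W :\ y)%SET (Zb x)).
    exact: (measurableT_comp (@measurable_proj R d _) mZb).
  have := @cond_mean_label _ _ _ P _ [tuple 0%N; t] _ _ _ _ (fun x => g (Yb x))
    _ (proj S0) _ i _ mkb (@measurable_proj R d S0) (measurableT_comp mg (mtnthZb y))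
    (fun=> g0 _) Hq.
  rewrite /= inE t0 => /(_ erefl).
  rewrite -ei.
  have -> : (fun o => g (Yb (o, e))) = (fun w => g (tnth (Z e w) y)).
    by apply/funext => w; rewrite /Yb ZbE.
  have -> // : (fun o => proj (W :\ y)%SET (Zb (o, e))) =
      (fun w => proj (W :\ y)%SET (Z e w)).
  by apply/funext => w; rewrite ZbE.
(* [mean] covers nonnegative functions, so it is applied to the positive and the negative part of
   [Y]; the common regression is the difference. *)
have iYp : Pb.-integrable setT (EFin^\+%E \o Yb).
  by rewrite -funepos_comp; exact: integrable_funepos.
have iYq : Pb.-integrable setT (EFin^\-%E \o Yb).
  by rewrite -funeneg_comp; exact: integrable_funeneg.
have [p Hp] := mean _ (measurable_funepos (@EFin_measurable R setT))
  (fun _ => funepos_ge0 _ _) iYp.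
have [q Hq] := mean _ (measurable_funeneg (@EFin_measurable R setT))
  (fun _ => funeneg_ge0 _ _) iYq.
pose m (a : d.+1.-tuple R) := p a - q a.
have reg e (S : {set 'I_d.+1}) : e = 0%N \/ e = t -> (S0 \subset S)%B ->
    (S \subset W :\ y)%B -> is_regression (mu e) S (m \o proj S0).
  move=> e0t S0S SW; apply: mean_function_regression S0S SW (iY _ e0t) _.
  apply: mean_function_posneg (iY _ e0t) _ _.
  - exact: (measurableT_comp (@measurable_proj R d _) (measurable_funP (Z e))).
  - exact: measurable_proj.
  - by rewrite funepos_comp; exact: Hp.
  - by rewrite funeneg_comp; exact: Hq.
split.
  by exists (m \o proj S0); split; apply: reg => //; [left|right].
move=> _ _ differ faithb S yS mut_pos.
have [SW|] := boolP (S \subset W)%B.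
  (* If all of [S] is unaffected, [m] composed with [proj S0] is a version of both regressions in
     environment [t], so they differ on a null set only. *)
  exfalso.
  have rS0 := reg t S0 (or_intror erefl) (fintype.subxx _) S0W.
  have S0S_W : (S0 :|: S \subset W :\ y)%SET.
    by rewrite finset.subUset S0W /= subsetD1 SW.
  have rS := reg t _ (or_intror erefl) (finset.subsetUl S0 S) S0S_W.
  have rS0' := regressionP rS0; have rS' := regressionP rS.
  have H0 := null_neq_trans (is_regression_measurable rS')
    (is_regression_measurable rS) (is_regression_measurable rS0')
    (is_regression_unique rS' rS) (is_regression_unique rS0 rS0').
  by move: mut_pos; rewrite lt0e => /andP[/eqP mut_neq0 _]; exact: mut_neq0 H0.
(* A node [b] of [S] outside [W] is an intervened child of [Y] or a descendant of one, hence a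
   descendant of [Y]. Independence given [X_S] would by faithfulness of the second augmented model
   block the open path through that child. *)
case/fintype.subsetPn => b bS bW; apply: differ => //.
- exists b => //; have /unaffectedP[i [yi _ ib]] := bW.
  by case: ib => [<-|ib]; [exact: pa_at|exact: at_trans (pa_at yi) ib].
- move=> indep; apply: (unaffected_d_separated yI bS bW).
  apply: faithb indep.
  + by rewrite disjoints1 finset.in_set1.
  + by rewrite disjoints1; apply/imsetP => -[].
  + by rewrite disjoints1; apply/imsetP => -[j jS [yj]]; rewrite -yj (negPf yS) in jS.
Qed.
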